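(* Let $Y$ be the $d$-dimensional multivariate CARMA process defined by $dX(t)=\mathbf{A}X(t)dt+E_p\,dL(t)$, $Y(t)=\underline{B}X(t)$, with $p>q>0$ and notation as in the context. Assume that $m\le d$, that $B_q$ and $B_q^TB_0$ have full rank $m$, and that the zeros of $\det\big(B_q^{\sim1}Q(z)\big)$ have strictly negative real parts. Then for every integer $n\ge1$ the increment $\Delta L_n=L(n)-L(n-1)$ is given by $$\begin{aligned}\Delta L_n=&\sum_{\nu=0}^{p-q-1}\Big[\mathcal{S}_q\mathcal{B}^{p-q-1-\nu}E_q+\sum_{k=\nu}^{p-q-2}A_{p-q-k-1}\mathcal{S}_q\mathcal{B}^{k-\nu}E_q\Big]\big[D^\nu Y(n)-D^\nu Y(n-1)\big]\\&+\Big[\underline{A}_q\mathcal{B}^{-1}+\sum_{k=1}^{p-q}A_{p-q-k+1}\mathcal{S}_q\mathcal{B}^{k-1}+\mathcal{S}_q\mathcal{B}^{p-q}\Big]\big[X_q(n)-X_q(n-1)\big]\\&+A_p\big[B_q^{\sim1}B_0\big]^{-1}B_q^{\sim1}\int_{n-1}^nY(s)\,ds,\end{aligned}$$ and $$X_q(n)=e^{\mathcal{B}}X_q(n-1)+\int_{n-1}^ne^{\mathcal{B}(n-u)}E_qY(u)\,du,\quad n\ge1.$$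
   Context: $L=(L(t))_{t\in\mathbb{R}}$ is a two-sided càdlàg $\mathbb{R}^m$-valued Lévy process. $A_1,\ldots,A_p\in M_m(\mathbb{R})$, $B_0,\ldots,B_q\in M_{d,m}(\mathbb{R})$, $Q(z)=B_0+B_1z+\ldots+B_qz^q$; $\mathbf{A}\in M_{pm}(\mathbb{R})$ is the block companion matrix with identity blocks $\mathbf{1}_m$ on the first block superdiagonal, last block row $[-A_p,\ldots,-A_1]$, zeros elsewhere; $E_p=[0,\ldots,0,\mathbf{1}_m]^T\in M_{pm,m}(\mathbb{R})$; $\underline{B}=[B_0\cdots B_{p-1}]\in M_{d,pm}(\mathbb{R})$ with $B_j=0$ for $j>q$. The process $X$ satisfies $X(t)=e^{\mathbf{A}(t-s)}X(s)+\int_s^te^{\mathbf{A}(t-u)}E_p\,dL(u)$ for $s<t$. $X^{(j)}(t)\in\mathbb{R}^m$ is the $j$th block of $m$ consecutive components of $X(t)$, $X_q=[X^{(1)T},\ldots,X^{(q)T}]^T$. $\underline{A}_q=[A_p\ A_{p-1}\cdots A_{p-q+1}]\in M_{m,mq}(\mathbb{R})$. $B_q^{\sim1}=(B_q^TB_q)^{-1}B_q^T$. $\mathcal{B}\in M_{mq}(\mathbb{R})$ is the block companion matrix with identity blocks $\mathbf{1}_m$ on the first block superdiagonal, last block row $[-B_q^{\sim1}B_0,\ldots,-B_q^{\sim1}B_{q-1}]$, zeros elsewhere (it is invertible under the assumptions); $E_q\in M_{mq,d}(\mathbb{R})$ has last block $B_q^{\sim1}$ and zeros elsewhere; $\mathcal{S}_q=[0,\ldots,0,\mathbf{1}_m]\in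 M_{m,mq}(\mathbb{R})$. Empty sums are zero. $D=d/dt$ is the pathwise derivative; the top-order derivative $D^{p-q-1}Y$ is understood as a right-hand derivative at jump times of $L$. *)

(* Defs.v *)
From HB Require Import structures.
From mathcomp Require Import all_boot all_order all_algebra.
From mathcomp Require Import all_classical all_reals all_analysis.
From mathcomp Require Import complex.

Set Implicit Arguments.
Unset Strict Implicit.
Unset Printing Implicit Defensive.

Import Order.TTheory GRing.Theory Num.Theory.
Import numFieldNormedType.Exports.

Local Open Scope classical_set_scope.
Local Open Scope ring_scope.

(* A vector made of p blocks of size m has dimension \sum_(i < p) m, the size
   used by MathComp's \mxblock, \mxrow, \mxcol and submxcol. Blocks are numbered
   from 0: X^(j) is block j - 1 of X. *)

Section block_matrices.
Variable R : realType.

Definition companion (p m : nat) (C : 'I_p -> 'M[R]_m) :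
    'M[R]_(\sum_(i < p) m) :=
  \mxblock_(i < p, j < p)
    (if i.+1 == p then C j
     else if (j : nat) == i.+1 then 1%:M else 0).

Definition last_block_col (p m d : nat) (K : 'M[R]_(m, d)) :
    'M[R]_(\sum_(i < p) m, d) :=
  \mxcol_(i < p) (if i.+1 == p then K else 0).

Definition last_block_row (q m : nat) : 'M[R]_(m, \sum_(i < q) m) :=
  \mxrow_(j < q) (if j.+1 == q then 1%:M else 0).

Definition left_inv (d m : nat) (M : 'M[R]_(d, m)) : 'M[R]_(m, d) :=
  invmx (M^T *m M) *m M^T.

(* A k and B k stand for A_k (1 <= k <= p) and B_k (0 <= k <= q); other
   values of the sequences are never used. *)
Section coefficients.
Variables (m d p q : nat) (A : nat -> 'M[R]_m) (B : nat -> 'M[R]_(d, m)).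

Definition boldA : 'M[R]_(\sum_(i < p) m) :=
  companion (fun j : 'I_p => - A (p - j)%N).

Definition boldE : 'M[R]_(\sum_(i < p) m, m) := last_block_col p 1%:M.

Definition underB : 'M[R]_(d, \sum_(i < p) m) :=
  \mxrow_(j < p) (if (j <= q)%N then B j else 0).

Definition underA : 'M[R]_(m, \sum_(i < q) m) :=
  \mxrow_(j < q) A (p - j)%N.

Definition calB : 'M[R]_(\sum_(i < q) m) :=
  companion (fun j : 'I_q => - (left_inv (B q) *m B j)).

Definition calE : 'M[R]_(\sum_(i < q) m, d) := last_block_col q (left_inv (B q)).

Definition toC (k l : nat) (M : 'M[R]_(k, l)) : 'M[R[i]]_(k, l) :=
  map_mx (real_complex R) M.

Definition Qpoly (z : R[i]) : 'M[R[i]]_(d, m) :=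
  \sum_(j < q.+1) z ^+ j *: toC (B j).

End coefficients.

Definition first_blocks (m p q : nat) (hqp : (q <= p)%N)
    (x : 'cV[R]_(\sum_(i < p) m)) : 'cV[R]_(\sum_(i < q) m) :=
  \mxcol_(i < q) submxcol x (widen_ord hqp i).

End block_matrices.

Section calculus.
Variable R : realType.

Definition expmx (n : nat) (M : 'M[R]_n) : 'M[R]_n :=
  lim (series (fun k => (k`!%:R)^-1 *: M ^+ k) @ \oo).

Definition integral_col (k : nat) (a b : R) (f : R -> 'cV[R]_k) : 'cV[R]_k :=
  \col_i \int[lebesgue_measure]_(u in `[a, b]) f u i ord0.

Definition cadlag (k : nat) (f : R -> 'cV[R]_k) :=
  forall t, f x @[x --> t^'+] --> f t /\ cvg (f x @[x --> t^'-]).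

Definition right_derive1 (k : nat) (f : R -> 'cV[R]_k) (t : R) : 'cV[R]_k :=
  lim (h^-1 *: (f (h + t) - f t) @[h --> 0^'+]).

(* D^nu f for 0 <= nu <= N, where N is the top order: the derivatives of order
   less than N are two-sided, the last differentiation is one-sided. At times
   where the two-sided N-th derivative exists the two notions agree. *)
Definition path_derive (k N nu : nat) (f : R -> 'cV[R]_k) : R -> 'cV[R]_k :=
  if (nu < N)%N then derive1n nu f
  else if N is N'.+1 then right_derive1 (derive1n N' f) else f.

End calculus.

Section processes.
Context (dsp : measure_display) (Omega : measurableType dsp) (R : realType).
Variable P : probability Omega R.

Definition borel (k : nat) : set (set 'cV[R]_k) := <<s @open 'cV[R]_k >>.

Definition random_vector (k : nat) (Z : Omega -> 'cV[R]_k) :=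
  forall C, @borel k C -> measurable (Z @^-1` C).

Record levy_process (m : nat) (L : R -> Omega -> 'cV[R]_m) : Prop := {
  levy_random : forall t, random_vector (L t) ;
  levy_start : {ae P, forall w, L 0 w = 0} ;
  levy_independent : forall (k : nat) (t : nat -> R) (C : nat -> set 'cV[R]_m),
    (forall i, (i < k)%N -> t i <= t i.+1) ->
    (forall i, (i < k)%N -> borel (C i)) ->
    P (\bigcap_(i in `I_k) [set w | C i (L (t i.+1) w - L (t i) w)]) =
    (\prod_(i < k) P [set w | C i (L (t i.+1) w - L (t i) w)%R])%E ;
  levy_stationary : forall (s t h : R) (C : set 'cV[R]_m),
    s <= t -> borel C ->
    P [set w | C (L (t + h) w - L (s + h) w)] =
    P [set w | C (L t w - L s w)] ;
  levy_stoch_continuous : forall (t e : R), 0 < e ->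
    P [set w | e <= `|L s w - L t w|] @[s --> t] --> 0%E ;
  levy_cadlag : {ae P, forall w, cadlag (L ^~ w)}
}.

(* I is (a version of) \int_s^t f(u) dL(u) for a deterministic f: the limit in
   probability of the sums \sum_k f(u_k) (L(u_(k+1)) - L(u_k)) over partitions
   s = u_0 < ... < u_n = t as the mesh tends to 0. *)
Definition stoch_integral (k m : nat) (f : R -> 'M[R]_(k, m))
    (L : R -> Omega -> 'cV[R]_m) (s t : R) (I : Omega -> 'cV[R]_k) : Prop :=
  random_vector I /\
  forall e eta : R, 0 < e -> 0 < eta -> exists2 delta : R, 0 < delta &
    forall (n : nat) (u : nat -> R),
      u 0%N = s -> u n = t ->
      (forall i, (i < n)%N -> 0 < u i.+1 - u i < delta) ->
      (P [set w | (e <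
          `|\sum_(i < n) f (u i) *m (L (u i.+1) w - L (u i) w) - I w|)%R]
       < eta%:E)%E.

(* dX(t) = M X(t) dt + E dL(t), read as its variation-of-constants formula, for
   a cadlag X. *)
Record state_process (k m : nat) (M : 'M[R]_k) (E : 'M[R]_(k, m))
    (L : R -> Omega -> 'cV[R]_m) (X : R -> Omega -> 'cV[R]_k) : Prop := {
  state_random : forall t, random_vector (X t) ;
  state_cadlag : {ae P, forall w, cadlag (X ^~ w)} ;
  state_eq : forall s t : R, s < t ->
    exists2 I : Omega -> 'cV[R]_k,
      stoch_integral (fun u => expmx ((t - u) *: M) *m E) L s t I &
      {ae P, forall w, X t w = expmx ((t - s) *: M) *m X s w + I w}
}.

End processes.

(* Main.v *)
Require Import Defs.
From mathcomp Require Import all_boot all_order all_algebra.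
From mathcomp Require Import all_classical all_reals all_analysis.
From mathcomp Require Import measurable_realfun complex.
From mathcomp Require Import ring lra zify.

Set Implicit Arguments.
Unset Strict Implicit.
Unset Printing Implicit Defensive.

Import Order.TTheory GRing.Theory Num.Theory.
Import numFieldNormedType.Exports.

Local Open Scope classical_set_scope.
Local Open Scope ring_scope.

(** Almost surely, [Z := X - E_p L] is continuous and has right derivative
[A X]. Indeed, by summation by parts and dominated convergence, the Riemann
sums of [\int_s^t f dL] converge along each cadlag path to
[f(t) L(t) - f(s) L(s) - \int_s^t f' L]; a limit in probability is almost surely
unique, so the variation-of-constants formula for [X] becomes one for [Z], first
at rational times and then, by right continuity, at all times.

The rest is calculus with right derivatives, which applies to cadlag integrands
and rests on one fact: a continuous function with zero right derivative is
constant. The blocks satisfy [D X^(j) = X^(j+1)], hence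
[D^nu Y = \sum_j B_j X^(nu+j+1)]. As [B_q^~1 B_q = 1], the shifted vectors
[xi_nu = (X^(nu+1), ..., X^(nu+q))] satisfy
[xi_(nu+1) = calB xi_nu + E_q D^nu Y]. For [nu = 0] this is a differential
equation for [X_q] driven by [Y]; iterating it expresses [X^(q+1), ..., X^(p)]
through [X_q] and the derivatives of [Y]. Inserting this into the last block
row, where [L] appears, and integrating [X_q]
by [calB^-1 (X_q - E_q \int Y)] gives the formula for [Delta L_n]. *)

(** * Right derivatives *)

Lemma cvg_sum (R : realType) (T : Type) (F : set_system T) (FF : Filter F)
    (I : Type) (r : seq I) (P : pred I) (u : I -> T -> R) (l : I -> R) :
  (forall i, u i x @[x --> F] --> l i) ->
  \sum_(i <- r | P i) u i x @[x --> F] --> \sum_(i <- r | P i) l i.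
Proof.
move=> ul; elim: r => [|i r IH].
  by under eq_fun do rewrite big_nil; rewrite big_nil; exact: cvg_cst.
under eq_fun do rewrite big_cons; rewrite big_cons.
by case: (P i) => //; exact: cvgD.
Qed.

Section right_derivative.
Variable R : realType.
Implicit Types (F G f g : R -> R) (a b t : R).

(** Stated as a convergence and not through [lim]: existence of the limit is part of it, and no
    default value can enter. *)
Definition rderiv F t (l : R) := h^-1 * (F (h + t) - F t) @[h --> 0^'+] --> l.

(* With a slack [e] in the slope, the last point of [[a, b]] where the bound
still holds cannot lie before [b]. *)
Lemma rderiv_le F a b (C : R) : a <= b -> continuous F ->
  (forall t, a <= t < b -> exists2 l, rderiv F t l & l <= C) ->
  F b - F a <= C * (b - a).
Proof.
move=> ab cF dF; apply/ler_addgt0Pr => e e0.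
(* The added [1] keeps the denominator positive when [a = b]; over [[a, b]] the larger slope [D]
   costs at most [e]. *)
set D := C + e / (b - a + 1).
have D_gt : C < D by rewrite ltrDl divr_gt0//; lra.
suff H : F b - F a <= D * (b - a).
  apply: (le_trans H); rewrite /D mulrDl lerD2l -mulrA ler_piMr ?(ltW e0)//.
  by rewrite mulrC ler_pdivrMr ?mul1r//; lra.
pose G x := F x - F a - D * (x - a).
suff : G b <= 0 by rewrite subr_le0.
have cG : continuous G.
  move=> x; apply: cvgB; first by apply: cvgB; [exact: cF|exact: cvg_cst].
  by apply: cvgM; [exact: cvg_cst|apply: cvgB; [exact: cvg_id|exact: cvg_cst]].
pose A := [set x | a <= x <= b /\ G x <= 0].
have Aa : A a by split; rewrite ?lexx// /G !subrr mulr0 subr0.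
have hA : has_sup A by split; [exists a|exists b => x [/andP[]]].
have ac : a <= sup A by apply: ub_le_sup => //; exact: (proj2 hA).
have cb : sup A <= b by apply: ge_sup; [exists a|move=> x [/andP[]]].
set c := sup A in ac cb *.
(* Otherwise [G] would be positive near [c] by continuity, while [A] has points arbitrarily close to
   [c]. *)
have Gc : G c <= 0.
  rewrite leNgt; apply/negP => Gc.
  have [r /= r0 hr] := [elaborate @cvgr_gt _ _ _ _ G (G c) (cG c) 0 Gc].
  have [x Ax cx] := sup_adherent r0 hA.
  have xc : x <= c by apply: ub_le_sup => //; exact: (proj2 hA).
  have : 0 < G x by apply: hr => /=; rewrite /ball_/= ger0_norm ?subr_ge0//;
    rewrite -/c in cx; lra.
  by case: Ax => _; rewrite leNgt => /negP.
have [<-//|cltb] := eqVneq c b.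
have {}cltb : c < b by rewrite lt_neqAle cltb.
have [l dl lC] : exists2 l, rderiv F c l & l <= C by apply: dF; rewrite ac.
have lD : l < D by exact: le_lt_trans D_gt.
(* The right derivative at [c] is below [D], so the bound survives a little past [c]; this
   contradicts the choice of [c] as supremum. *)
have : \forall h \near 0^'+, A (h + c).
  near=> h.
  have h0 : 0 < h by near: h; exact: nbhs_right_gt.
  have hb : h < b - c by near: h; apply: nbhs_right_lt; rewrite subr_gt0.
  have hl : h^-1 * (F (h + c) - F c) < D by near: h; exact: (cvgr_lt l).
  split; first by apply/andP; split; lra.
  move: hl; rewrite mulrC ltr_pdivrMr// => hl.
  by move: Gc; rewrite /G => Gc; nra.
move=> nearA.
have : \forall h \near 0^'+, A (h + c) /\ 0 < h.
  near=> h; split; last by near: h; exact: nbhs_right_gt.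
  by near: h.
move/filter_ex => [h [Ah h0]].
have : h + c <= c by apply: ub_le_sup => //; exact: (proj2 hA).
by lra.
Unshelve. all: by end_near. Qed.

Lemma rderiv_near F G t l : (\forall h \near 0^'+, F (h + t) = G (h + t)) ->
  F t = G t -> rderiv G t l -> rderiv F t l.
Proof.
move=> FG FGt; apply: cvg_trans; apply: near_eq_cvg; near=> h.
by rewrite FGt; congr (_ * (_ - _)); apply/esym; near: h.
Unshelve. all: by end_near. Qed.

Lemma rderiv_cst (c : R) t : rderiv (fun=> c) t 0.
Proof.
rewrite /rderiv; under eq_fun do rewrite subrr mulr0; exact: cvg_cst.
Qed.

Lemma rderivD F G t l k : rderiv F t l -> rderiv G t k ->
  rderiv (fun x => F x + G x) t (l + k).
Proof.
move=> dF dG; rewrite /rderiv.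
under eq_fun do rewrite opprD addrACA mulrDr.
exact: cvgD.
Qed.

Lemma rderivN F t l : rderiv F t l -> rderiv (fun x => - F x) t (- l).
Proof.
move=> dF; rewrite /rderiv.
under eq_fun do rewrite -opprD mulrN.
exact: cvgN.
Qed.

Lemma rderiv_right_continuous F t l : rderiv F t l ->
  F (h + t) @[h --> 0^'+] --> F t.
Proof.
move=> dF.
have idc : (h : R) @[h --> 0^'+] --> (0 : R).
  by apply: cvg_at_right_filter; exact: cvg_id.
have H : h * (h^-1 * (F (h + t) - F t)) @[h --> 0^'+] --> 0 * l.
  exact: cvgM.
have H2 : h * (h^-1 * (F (h + t) - F t)) + F t @[h --> 0^'+] --> 0 * l + F t.
  by apply: cvgD H _; exact: cvg_cst.
rewrite mul0r add0r in H2.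
apply: cvg_trans H2; apply: near_eq_cvg; near=> h.
rewrite mulrA divff ?mul1r ?subrK// gt_eqF//; near: h; exact: nbhs_right_gt.
Unshelve. all: by end_near. Qed.

Lemma rderivM F G t l k : rderiv F t l -> rderiv G t k ->
  rderiv (fun x => F x * G x) t (l * G t + F t * k).
Proof.
move=> dF dG; rewrite /rderiv.
have E h : h^-1 * (F (h + t) * G (h + t) - F t * G t) =
    h^-1 * (F (h + t) - F t) * G (h + t) + F t * (h^-1 * (G (h + t) - G t)).
  by ring.
under eq_fun do rewrite E.
apply: cvgD; apply: cvgM => //; last exact: cvg_cst.
exact: (rderiv_right_continuous dG).
Qed.

Lemma rderiv_sum (I : finType) (F : I -> R -> R) (l : I -> R) t :
  (forall i, rderiv (F i) t (l i)) ->
  rderiv (fun x => \sum_i F i x) t (\sum_i l i).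
Proof.
move=> dF; rewrite /rderiv.
under eq_fun do rewrite -sumrB mulr_sumr.
by apply: cvg_sum => i; exact: dF.
Qed.

Lemma is_derive_rderiv F t l : is_derive t 1 F l -> rderiv F t l.
Proof.
case=> dF <-; move: dF; rewrite /derivable => /cvg_ex[l' dF].
have /cvg_lim E := dF; rewrite /derive E// => A /dF [e /= e0 He].
exists e => //= x Hx x0; have := He x Hx; rewrite gt_eqF//= => /(_ isT).
by rewrite /GRing.scale/= mulr1.
Qed.

(** Near [t] the right derivative stays within [d] of [g t]. Applied to [F] and [- F], [rderiv_le]
    turns this into a bound on the difference quotients on both sides of [t], although only right
    derivatives are given. *)
Lemma rderiv_is_derive F g t (e : R) : 0 < e -> continuous F ->
  (forall x, `|x - t| < e -> rderiv F x (g x)) -> {for t, continuous g} ->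
  h^-1 * (F (h + t) - F t) @[h --> 0^'] --> g t.
Proof.
move=> e0 cF dF cg; apply/cvgrPdist_le => d d0 /=.
have [r /= r0 hr] : \forall x \near t, `|g t - g x| <= d.
  by move/cvgrPdist_le : cg; apply.
exists (Num.min e r) => /=; first by rewrite lt_min e0.
move=> h /=; rewrite /ball_/= sub0r normrN lt_min => /andP[he hr'] h0.
(* Two ordered points near [t]: this serves [[t, h + t]] when [h > 0] and [[h + t, t]] when
   [h < 0]. *)
have key a b : a < b -> `|a - t| <= `|h| -> `|b - t| <= `|h| ->
    `|F b - F a - g t * (b - a)| <= d * (b - a).
  move=> ab ah bh.
  have inn x : a <= x < b -> `|x - t| < e /\ `|g t - g x| <= d.
    move=> /andP[ax xb]; have xh : `|x - t| <= `|h|.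
      by move: ah bh; rewrite !ler_norml => /andP[? ?] /andP[? ?]; apply/andP;
        split; lra.
    split; first by exact: le_lt_trans he.
    by apply: hr => /=; rewrite /ball_/= distrC; exact: le_lt_trans hr'.
  rewrite ler_norml; apply/andP; split.
    have : (- F b) - (- F a) <= (d - g t) * (b - a).
      apply: (@rderiv_le (fun x => - F x)); first exact: ltW.
        by move=> x; apply: cvgN; exact: cF.
      move=> x /inn[xe xd]; exists (- g x); first exact/rderivN/dF.
      by move: xd; rewrite ler_norml => /andP[? ?]; lra.
    lra.
  have : F b - F a <= (d + g t) * (b - a).
    apply: rderiv_le => //; first exact: ltW.
    move=> x /inn[xe xd]; exists (g x); first exact/dF.
    by move: xd; rewrite ler_norml => /andP[? ?]; lra.
  lra.
have [hp|hn|/eqP] := ltrgt0P h; last by rewrite (negbTE h0).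
- have := key t (h + t); rewrite subrr normr0 normr_ge0 addrK lexx ltrDr =>
  /(_ hp isT isT) H.
  have -> : g t - h^-1 * (F (h + t) - F t) =
      - (h^-1 * (F (h + t) - F t - g t * h)).
    by field.
  by rewrite normrN normrM normfV (gtr0_norm hp) mulrC ler_pdivrMr//.
- have := key (h + t) t; rewrite subrr normr0 normr_ge0 addrK lexx gtrDr =>
  /(_ hn isT isT) H.
  have -> : g t - h^-1 * (F (h + t) - F t) =
      h^-1 * (F t - F (h + t) - g t * (t - (h + t))).
    by field.
  rewrite normrM normfV (ltr0_norm hn) mulrC ler_pdivrMr ?oppr_gt0//.
  by apply: (le_trans H); lra.
Unshelve. all: by end_near. Qed.

End right_derivative.

(** * Right-continuous integrands *)

Section right_continuous_locally_bounded.
Variable R : realType.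
Implicit Types (F G f g : R -> R) (a b s t : R).
Let mu := @lebesgue_measure R.

(** Right continuity yields measurability and the right derivative of the primitive; local
    boundedness yields integrability. The class contains the cadlag functions, is stable under sums
    and products, and by [rclb_grid] also contains the step functions [g \o grid]. *)
Definition rcont_locbounded g := (forall t, g x @[x --> t^'+] --> g t) /\
  forall a b, exists K, forall x, a <= x <= b -> `|g x| <= K.

Local Notation rclb := rcont_locbounded.

Lemma continuous_rclb g : continuous g -> rclb g.
Proof.
move=> cg; split; first by move=> t; apply: cvg_at_right_filter; exact: cg.
move=> a b; have [ab|ba] := leP a b; last first.
  by exists 0 => x /andP[ax xb]; have := le_trans ax xb; rewrite leNgt ba.
have cng : {within `[a, b], continuous (fun x => `|g x|)}.
  by apply: continuous_subspaceT => x; apply: cvg_norm; exact: cg.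
have [c _ hc] := EVT_max ab cng.
by exists `|g c| => x xab; apply: hc; rewrite in_itv.
Qed.

Lemma rclb_cst (c : R) : rclb (fun=> c).
Proof. by apply: continuous_rclb => x; exact: cvg_cst. Qed.

Lemma rclbD f g : rclb f -> rclb g -> rclb (fun x => f x + g x).
Proof.
move=> [rf bf] [rg bg]; split; first by move=> t; apply: cvgD.
move=> a b; have [K hK] := bf a b; have [L hL] := bg a b.
exists (K + L) => x xab; apply: le_trans (ler_normD _ _) _.
by rewrite lerD ?hK ?hL.
Qed.

Lemma rclbM f g : rclb f -> rclb g -> rclb (fun x => f x * g x).
Proof.
move=> [rf bf] [rg bg]; split; first by move=> t; apply: cvgM.
move=> a b; have [K hK] := bf a b; have [L hL] := bg a b.
by exists (K * L) => x xab; rewrite normrM ler_pM ?hK ?hL.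
Qed.

Lemma rclb_sum (I : Type) (r : seq I) (f : I -> R -> R) :
  (forall i, rclb (f i)) -> rclb (fun x => \sum_(i <- r) f i x).
Proof.
move=> rf; elim: r => [|i r IH].
  by under eq_fun do rewrite big_nil; exact: rclb_cst.
by under eq_fun do rewrite big_cons; exact: rclbD.
Qed.

(** The two one-sided limits bound [g] near each point, and compactness of [[a, b]] makes one bound
    serve everywhere. *)
Lemma cadlag_rclb g :
  (forall t, g x @[x --> t^'+] --> g t /\ cvg (g x @[x --> t^'-])) -> rclb g.
Proof.
move=> cg; split=> [t|a b]; first by case: (cg t).
have := @segment_compact R a b; rewrite compact_near_coveringP => H.
have : \forall K \near +oo, `[a, b]%classic `<=` (fun x => `|g x| <= K).
  apply: H => x _.
  have [/cvgrPdist_le/(_ 1 ltr01) gr /cvg_ex[l /cvgrPdist_le/(_ 1 ltr01) gl]] :=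
    cg x.
  have gn : \forall y \near x, `|g y| <= `|g x| + `|l| + 1.
    move: gr gl => [r /= r0 hr] [r' /= r'0 hl].
    exists (Num.min r r') => /=; first by rewrite lt_min r0.
    move=> y; rewrite /ball_/= lt_min => /andP[yr yr'].
    have n1 := normr_ge0 (g x). have n2 := normr_ge0 l.
    have [xy|yx|<-] := ltgtP x y; last by lra.
      have := hr y yr xy; have := ler_distD (g x) (g y) 0.
      by rewrite !subr0 (distrC (g y)); lra.
    have := hl y yr' yx; have := ler_distD l (g y) 0.
    by rewrite !subr0 (distrC (g y)); lra.
  near=> y K => /=.
  apply: (@le_trans _ _ (`|g x| + `|l| + 1)); first by near: y.
  by near: K; apply: nbhs_pinfty_ge; rewrite num_real.
move=> /filter_ex[K hK]; exists K => x xab; apply: hK => /=.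
by rewrite in_itv.
Unshelve. all: by end_near. Qed.

(* The first point of [s + h Z] strictly to the right of [x]: as [h] tends to
[0], right continuity alone controls it. *)
Definition grid s (h : R) x := s + h * (Num.floor ((x - s) / h) + 1)%:~R.

Lemma grid_itv s h x : 0 < h -> x < grid s h x <= x + h.
Proof.
move=> h0; have /andP[] := floor_itv ((x - s) / h).
rewrite ler_pdivlMr// ltr_pdivrMr// /grid !intrD.
by move=> ? ?; apply/andP; split; lra.
Qed.

Lemma gridE s h x (z : int) : 0 < h ->
  s + h * z%:~R <= x < s + h * (z + 1)%:~R -> grid s h x = s + h * (z + 1)%:~R.
Proof.
move=> h0 /andP[h1 h2]; rewrite /grid (@floor_def _ _ z)//.
by rewrite ler_pdivlMr// ltr_pdivrMr// !(mulrC _ h); apply/andP; split; lra.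
Qed.

(** Since [grid] is constant on each cell, every preimage is a countable union of cells, whatever
    [g] is. *)
Lemma measurable_fun_grid g s h : 0 < h ->
  measurable_fun [set: R] (fun x => g (grid s h x)).
Proof.
move=> h0 _ Y mY; rewrite setTI.
pose I (z : int) : set R := if `[< Y (g (s + h * (z + 1)%:~R)) >]
  then `[s + h * z%:~R, s + h * (z + 1)%:~R[%classic else set0.
rewrite (_ : _ @^-1` _ = \bigcup_z I z); last first.
  apply/seteqP; split=> x /=.
    move=> Yx; exists (Num.floor ((x - s) / h)) => //.
    rewrite /I asboolT//= in_itv/=.
    have /andP[] := floor_itv ((x - s) / h).
    by rewrite ler_pdivlMr// ltr_pdivrMr// !(mulrC _ h) => ? ?; apply/andP;
      split; lra.
  case=> z _; rewrite /I; case: asboolP => // Yz /=; rewrite in_itv/= => hx.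
  by rewrite (gridE h0 hx).
apply: countable_bigcupT_measurable => [|z]; first exact: countableP.
by rewrite /I; case: ifP.
Qed.

Lemma cvg_grid g s t (h : R^nat) : (forall n, 0 < h n) -> h n @[n --> \oo] -->
  0 ->
  (g x @[x --> t^'+] --> g t) -> g (grid s (h n) t) @[n --> \oo] --> g t.
Proof.
move=> h0 hc /cvg_at_rightP; apply; split.
  by move=> n; have /andP[] := grid_itv s t (h0 n).
apply: (@squeeze_cvgr _ _ _ _ (fun=> t) (fun n => t + h n)).
- by near=> n; have /andP[/ltW -> ->] := grid_itv s t (h0 n).
- exact: cvg_cst.
- by rewrite -[X in _ --> X]addr0; apply: cvgD => //; exact: cvg_cst.
Unshelve. all: by end_near. Qed.

Lemma rclb_grid g s h : 0 < h -> rclb g -> rclb (fun x => g (grid s h x)).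
Proof.
move=> h0 [rg bg]; split => [t|a b].
  apply: cvg_near_cst.
  have /andP[] := floor_itv ((t - s) / h).
  rewrite ler_pdivlMr// ltr_pdivrMr// => h1 h2.
  near=> x; congr g.
  rewrite (@gridE s h x (Num.floor ((t - s) / h)) h0) //.
  have xt : t < x by near: x; exact: nbhs_right_gt.
  have xt2 : x < s + h * (Num.floor ((t - s) / h) + 1)%:~R.
    by near: x; apply: nbhs_right_lt; rewrite mulrC; lra.
  rewrite xt2 andbT mulrC; lra.
have [K hK] := bg a (b + h); exists K => x /andP[ax xb]; apply: hK.
by have /andP[? ?] := grid_itv s x h0; apply/andP; split; lra.
Unshelve. all: by end_near. Qed.

(** By right continuity [g] is the pointwise limit of its step approximations on grids of mesh
    [1/(n+1)]. *)
Lemma rclb_measurable g : rclb g -> measurable_fun [set: R] g.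
Proof.
move=> [rg _]; apply: (@measurable_fun_cvg _ _ _ _
  (fun n x => g (grid 0 n.+1%:R^-1 x))).
  by move=> n; apply: measurable_fun_grid; rewrite invr_gt0.
move=> x _; apply: (@cvg_grid g 0 x (fun n => n.+1%:R^-1)) => //.
  exact: cvg_harmonic.
Qed.

Lemma rclb_integrable g a b : rclb g -> mu.-integrable `[a, b] (EFin \o g).
Proof.
move=> rg; apply: measurable_bounded_integrable => //.
- by rewrite /= lebesgue_measure_itv/=; case: ifP => // _; rewrite -EFinB ltry.
- apply: measurable_funTS; exact: rclb_measurable.
have [K hK] := rg.2 a b; exists K; split; first by rewrite num_real.
by move=> M KM x /= xab; apply: le_trans (ltW KM); apply: hK;
  rewrite in_itv in xab.
Qed.

Lemma rclb_Rintegral_le g a b (C : R) : rclb g -> a <= b ->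
  (forall x, a <= x <= b -> `|g x| <= C) ->
  `|\int[mu]_(x in `[a, b]) g x| <= C * (b - a).
Proof.
move=> rg ab gC.
apply: (@le_trans _ _ (\int[mu]_(x in `[a, b]) `|g x|)).
  by apply: le_normr_Rintegral => //; exact: rclb_integrable.
apply: (@le_trans _ _ (\int[mu]_(x in `[a, b]) C)).
  apply: le_Rintegral => //.
  - have := integrable_norm (rclb_integrable a b rg); exact.
  - by apply: rclb_integrable; exact: rclb_cst.
rewrite Rintegral_cst//= lebesgue_measure_itv/= lte_fin.
by case: ltP => // ba; rewrite mulr0; have -> : b = a by [lra];
  rewrite subrr mulr0.
Qed.

End right_continuous_locally_bounded.

(** * Primitives of right-continuous integrands and the fundamental theorem of calculus *)

Section primitives.
Variable R : realType.
Implicit Types (F G f g : R -> R) (a b s t : R).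
Let mu := @lebesgue_measure R.

Local Notation rclb := (@rcont_locbounded R).

Lemma rderiv_eq F a b : a <= b -> continuous F ->
  (forall t, a <= t < b -> rderiv F t 0) -> F b = F a.
Proof.
move=> ab cF dF.
have H1 : F b - F a <= 0 * (b - a).
  by apply: rderiv_le => // t /dF; exists 0.
have H2 : (- F b) - (- F a) <= 0 * (b - a).
  apply: (@rderiv_le _ (fun x => - F x)) => // [x|t /dF dFt].
    by apply: cvgN; exact: cF.
  by exists 0 => //; rewrite -oppr0; exact: rderivN.
by apply/eqP; rewrite eq_le; apply/andP; split; lra.
Qed.

Lemma Rintegral_increment g a s t : rclb g -> a <= s <= t ->
  \int[mu]_(x in `[a, t]) g x - \int[mu]_(x in `[a, s]) g x =
  \int[mu]_(x in `[s, t]) g x.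
Proof.
move=> rg /andP[as_ st].
rewrite Rintegral_itvB ?bnd_simp//; last exact: rclb_integrable.
rewrite Rintegral_itv_obnd_cbnd//.
apply: integrableS (rclb_integrable s t rg) => //.
by apply: subset_itvr; rewrite bnd_simp.
Qed.

(** Below [a] the interval is empty and the integral vanishes; hence the primitive can be continuous
    on the whole line. *)
Lemma Rintegral_primitive_max g a t :
  \int[mu]_(x in `[a, t]) g x = \int[mu]_(x in `[a, Num.max a t]) g x.
Proof.
have [//|ta] := leP a t.
by rewrite set_itv1 Rintegral_set1 set_itv_ge ?Rintegral_set0 ?bnd_simp -?ltNge.
Qed.

(** To the right of [a] the primitive is locally Lipschitz, with a local bound of [g] as constant,
    and [Num.max a] does not increase distances. *)
Lemma Rintegral_primitive_continuous g a : rclb g ->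
  continuous (fun t => \int[mu]_(x in `[a, t]) g x).
Proof.
move=> rg t; have [K hK] := rg.2 a (Num.max a t + 1).
have lip s r : a <= s <= r -> r <= Num.max a t + 1 ->
    `|\int[mu]_(x in `[a, r]) g x - \int[mu]_(x in `[a, s]) g x| <=
      `|K| * (r - s).
  move=> asr rt; have /andP[as_ sr] := asr.
  rewrite Rintegral_increment// rclb_Rintegral_le// => x /andP[sx xr].
  by apply: le_trans (hK x _) (ler_norm _); apply/andP; split; lra.
have {}lip s r : a <= s <= Num.max a t + 1 -> a <= r <= Num.max a t + 1 ->
    `|\int[mu]_(x in `[a, r]) g x - \int[mu]_(x in `[a, s]) g x| <=
      `|K| * `|r - s|.
  move=> /andP[as_ st] /andP[ar rt]; have [sr|rs] := leP s r.
    by rewrite (_ : `|r - s| = r - s) ?lip ?as_// ger0_norm// subr_ge0.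
  have -> : `|r - s| = s - r by rewrite distrC ger0_norm// subr_ge0 ltW.
  by rewrite distrC; apply: lip => //; rewrite ar ltW.
apply/cvgrPdist_le => e e0; have K0 : 0 <= `|K| by [].
(* Distance [1] keeps [x] in the range where [K] bounds [g]; the other term makes the Lipschitz
   estimate at most [e], even if [K = 0]. *)
have d0 : 0 < Num.min 1 (e / (`|K| + 1)) by rewrite lt_min ltr01 divr_gt0//;
  lra.
exists (Num.min 1 (e / (`|K| + 1))) => //= x.
rewrite /ball_/= lt_min => /andP[tx1 txe].
have maxd : `|Num.max a t - Num.max a x| <= `|t - x|.
  have [at_|ta] := leP a t; have [ax|xa] := leP a x; rewrite ?subrr//.
  - by rewrite ger0_norm ?subr_ge0//; apply: le_trans (ler_norm _); lra.
  - by rewrite (distrC a) (distrC t) ger0_norm ?subr_ge0//;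
    apply: le_trans (ler_norm _); lra.
  - by rewrite normr0.
rewrite (Rintegral_primitive_max g a t) (Rintegral_primitive_max g a x).
apply: (@le_trans _ _ (`|K| * `|Num.max a t - Num.max a x|)).
  have xt1 : Num.max a x <= Num.max a t + 1.
    by move: maxd; rewrite ler_norml => /andP[? ?]; lra.
  by apply: lip; rewrite ?xt1 ?le_max ?lexx//=; lra.
apply: (@le_trans _ _ (`|K| * (e / (`|K| + 1)))).
  by apply: ler_wpM2l => //; exact: le_trans maxd (ltW txe).
by rewrite mulrCA ler_piMr ?(ltW e0)// ler_pdivrMr ?mul1r; lra.
Qed.

Lemma Rintegral_primitive_rderiv g a t : rclb g -> a <= t ->
  rderiv (fun t => \int[mu]_(x in `[a, t]) g x) t (g t).
Proof.
move=> rg at_; apply/cvgrPdist_le => e e0.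
have /cvgrPdist_le/(_ e e0) [r /= r0 hr] := rg.1 t.
near=> h.
have h0 : 0 < h by near: h; exact: nbhs_right_gt.
have hr' : h < r by near: h; exact: nbhs_right_lt.
have hD : t <= h + t by lra.
rewrite Rintegral_increment ?at_//.
(* With [g t] written as the mean of a constant, only [g x - g t] on [[t, h + t]] remains to be
   estimated. *)
have -> : g t = h^-1 * \int[mu]_(x in `[t, h + t]) g t.
  rewrite Rintegral_cst//= lebesgue_measure_itv/= lte_fin ltrDr h0 -EFinB/=
    addrK.
  by rewrite mulrC mulfK// gt_eqF.
have rc : rclb (fun=> g t) by exact: rclb_cst.
rewrite -mulrBr -RintegralB//; try exact: rclb_integrable.
rewrite normrM normfV (gtr0_norm h0) mulrC ler_pdivrMr//.
have -> : e * h = e * (h + t - t) by rewrite addrK.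
apply: rclb_Rintegral_le => //.
  apply: rclbD => //.
  have -> : (fun x => - g x) = (fun x => -1 * g x) by apply/funext => x;
    rewrite mulN1r.
  by apply: rclbM => //; exact: rclb_cst.
move=> x /andP[tx xh]; have [->|tx'] := eqVneq x t;
  first by rewrite subrr normr0 ltW.
apply: hr; last by rewrite lt_neqAle eq_sym tx'.
by rewrite /ball_/= distrC ger0_norm; lra.
Unshelve. all: by end_near. Qed.

(** Subtracting the primitive of [g] from [F] leaves a continuous function with zero right
    derivative. *)
Lemma rderiv_FTC F g a b : a <= b -> continuous F -> rclb g ->
  (forall t, a <= t < b -> rderiv F t (g t)) ->
  F b - F a = \int[mu]_(x in `[a, b]) g x.
Proof.
move=> ab cF rg dF; pose V t := \int[mu]_(x in `[a, t]) g x.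
have : F b - V b = F a - V a.
  apply: (@rderiv_eq (fun x => F x - V x)) => //.
    by move=> x; apply: cvgB; [exact: cF|exact: Rintegral_primitive_continuous].
  move=> t tab; rewrite -(subrr (g t)); apply: rderivD; first exact: dF.
  by apply: rderivN; apply: Rintegral_primitive_rderiv => //; case/andP: tab.
by rewrite /V [in X in _ = _ - X]set_itv1 Rintegral_set1 => H; lra.
Qed.

Lemma cvg_Rintegral_bounded (g_ : nat -> R -> R) g a b (K : R) :
  (forall n, rclb (g_ n)) -> rclb g ->
  (forall x, g_ n x @[n --> \oo] --> g x) ->
  (forall n x, a <= x <= b -> `|g_ n x| <= K) ->
  \int[mu]_(x in `[a, b]) g_ n x @[n --> \oo] --> \int[mu]_(x in `[a, b]) g x.
Proof.
move=> rg_ rg cg bg.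
have rK : rclb (fun=> K) by exact: rclb_cst.
have [//||||||ig _ c] := @dominated_convergence _ _ _ mu `[a, b]%classic _
  (fun n x => (g_ n x)%:E) (fun x => (g x)%:E) (fun=> K%:E).
- by move=> n; apply/measurable_EFinP; apply: measurable_funTS;
  exact: rclb_measurable.
- by apply/measurable_EFinP; apply: measurable_funTS; exact: rclb_measurable.
- by apply: aeW => x _; apply: cvg_EFin => //; [exact: nearW|exact: cg].
- exact: rclb_integrable rK.
- by apply: aeW => x n /=; rewrite in_itv/= lee_fin; exact: bg.
apply: fine_cvg; apply: cvg_trans c _.
by rewrite fineK//; apply: integrable_fin_num => //; exact: rclb_integrable.
Qed.

(* Summation by parts leaves [\sum_i (f (u i.+1) - f (u i)) * l (u i.+1)], which
is exactly the integral of [f'] times the step function [l \o grid]. *)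
Lemma cvg_Stieltjes_sum f f' (l : R -> R) s t : s < t ->
  continuous f -> (forall x, rderiv f x (f' x)) -> rclb f' -> rclb l ->
  let u (n i : nat) := s + (t - s) / n.+1%:R * i%:R in
  \sum_(i < n.+1) f (u n i) * (l (u n i.+1) - l (u n i)) @[n --> \oo] -->
  f t * l t - f s * l s - \int[mu]_(x in `[s, t]) (f' x * l x).
Proof.
move=> st cf df rf' rl u; pose h (n : nat) := (t - s) / n.+1%:R.
have h0 n : 0 < h n by rewrite divr_gt0// subr_gt0.
have uS n i : u n i.+1 = u n i + h n.
  by rewrite /u -(@natr1 R i) mulrDr mulr1 addrA.
pose g n x := f' x * l (grid s (h n) x).
have rg n : rclb (g n) by apply: rclbM => //; exact: rclb_grid.
pose H n x := \int[mu]_(y in `[s, x]) g n y.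
have us n i : s <= u n i by rewrite lerDl mulr_ge0// ltW//; exact: h0.
(* On this cell [l \o grid] is the constant [l (u n i.+1)], so [H n] and [f] times that constant
   have the same right derivative. *)
have HE n i : H n (u n i.+1) - H n (u n i) =
    (f (u n i.+1) - f (u n i)) * l (u n i.+1).
  have : H n (u n i.+1) - f (u n i.+1) * l (u n i.+1) =
         H n (u n i) - f (u n i) * l (u n i.+1).
    apply: (@rderiv_eq (fun x => H n x - f x * l (u n i.+1))).
    - by rewrite uS lerDl ltW.
    - move=> x; apply: cvgB; first exact: Rintegral_primitive_continuous.
      by apply: cvgM; [exact: cf|exact: cvg_cst].
    move=> x /andP[ux xu].
    have -> : (0 : R) = g n x + - (f' x * l (u n i.+1) + f x * 0).
      rewrite mulr0 addr0 /g (@gridE _ s (h n) x i (h0 n)).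
        by rewrite intrD1 -pmulrn natr1 subrr.
      by move: ux xu; rewrite intrD1 -pmulrn natr1 /u -/(h n) => -> ->.
    apply: rderivD.
      by apply: Rintegral_primitive_rderiv => //; exact: le_trans (us n i) ux.
    by apply/rderivN/rderivM; last exact: rderiv_cst.
  by move=> E; lra.
have un n : u n n.+1 = t by rewrite /u divfK ?pnatr_eq0// addrC subrK.
have u0 n : u n 0%N = s by rewrite /u mulr0 addr0.
have sumE n : \sum_(i < n.+1) f (u n i) * (l (u n i.+1) - l (u n i)) =
    f t * l t - f s * l s - H n t.
  (* By [HE], the increments of [G] are exactly the terms of the Riemann sum, which therefore
     telescopes. *)
  pose G i := f (u n i) * l (u n i) - H n (u n i).
  transitivity (\sum_(i < n.+1) (G i.+1 - G i)).
    by apply: eq_bigr => i _; rewrite /G; have := HE n i; lra.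
  rewrite -(big_mkord xpredT (fun i => G i.+1 - G i)) telescope_sumr// /G un u0.
  have -> : H n s = 0 by rewrite /H set_itv1 Rintegral_set1.
  by lra.
under eq_fun do rewrite sumE.
apply: cvgB; first exact: cvg_cst.
(* [grid] may overshoot [t], but by at most [h n <= t - s]; so [l] has to be bounded on this longer
   interval. *)
have [K hK] := rl.2 s (t + (t - s)).
have [K' hK'] := rf'.2 s t.
apply: (@cvg_Rintegral_bounded _ _ _ _ (K' * K)) => //.
- exact: rclbM.
- move=> x; apply: cvgM; first exact: cvg_cst.
  apply: cvg_grid => //; last exact: rl.1.
  rewrite -[X in _ --> X](mulr0 (t - s)); apply: cvgM; first exact: cvg_cst.
  exact: cvg_harmonic.
- move=> n x /andP[sx xt]; rewrite normrM ler_pM// ?hK' ?sx//.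
  apply: hK; have /andP[g1 g2] := grid_itv s x (h0 n).
  have : h n <= t - s by rewrite /h ler_pdivrMr// ler_peMr ?subr_ge0 ?(ltW st)//
    ler1n.
  by move=> ?; apply/andP; split; lra.
Qed.

End primitives.

(** * The matrix exponential *)

Section matrix_exponential.
Variable R : realType.

Lemma cvg_mx (T : Type) (F : set_system T) (FF : Filter F) (k l : nat)
    (f : T -> 'M[R]_(k, l)) (L : 'M[R]_(k, l)) :
  (forall i j, f x i j @[x --> F] --> L i j) -> f x @[x --> F] --> L.
Proof.
move=> fL; apply/cvg_ballP => e e0.
have : \forall x \near F, forall ij : 'I_k * 'I_l,
  ball (L ij.1 ij.2) e (f x ij.1 ij.2).
  by apply: filter_forall => -[i j]; have /cvg_ballP := fL i j; exact.
by apply: filterS => x fx; split => // i j; exact: (fx (i, j)).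
Qed.

Variable n : nat.
Implicit Types (M N : 'M[R]_n) (t : R).

Lemma exp_mx_scale M t k : (t *: M) ^+ k = t ^+ k *: M ^+ k.
Proof.
elim: k => [|k IH]; first by rewrite !expr0 scale1r.
by rewrite !exprS IH -!mulmxE -scalemxAl -scalemxAr scalerA.
Qed.

(** A crude matrix norm: it dominates all entries and all column sums of absolute values, which is
    enough to bound powers geometrically. *)
Let msum M : R := \sum_i \sum_j `|M i j|.

Lemma norm_exp_mx_entry M k i j : `|(M ^+ k) i j| <= msum M ^+ k.
Proof.
elim: k i j => [|k IH] i j.
  by rewrite !expr0 mxE; case: eqP; rewrite ?normr1 ?normr0.
have m0 : 0 <= msum M by apply: sumr_ge0 => ? _; apply: sumr_ge0.
rewrite exprSr -mulmxE mxE (le_trans (ler_norm_sum _ _ _))//.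
apply: (@le_trans _ _ (\sum_l msum M ^+ k * `|M l j|)).
  by apply: ler_sum => l _; rewrite normrM ler_wpM2r.
rewrite -mulr_sumr exprSr ler_wpM2l ?exprn_ge0//.
apply: ler_sum => l _; rewrite (bigD1 j)//= lerDl.
by apply: sumr_ge0.
Qed.

(** The comparison series is [msum N] times the exponential series at [msum M * |t|]. The factor [N]
    is there for the termwise derivatives, where it becomes a power of [M]. *)
Lemma is_cvg_exp_mx_entry M N i j t :
  cvgn (pseries (fun k => (k`!%:R)^-1 * (N *m M ^+ k) i j) t).
Proof.
rewrite /pseries; apply: normed_cvg => /=.
have m0 A : 0 <= msum A by apply: sumr_ge0 => ? _; apply: sumr_ge0.
have c1 := is_cvg_series_exp_coeff (msum M * `|t|).
have c2 := @is_cvg_seriesZ _ _ (msum N) c1.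
apply: series_le_cvg c2; rewrite /= /exp_coeff/=.
- by move=> k.
- move=> k; change (0 <= msum N * ((msum M * `|t|) ^+ k / k`!%:R)).
  by rewrite mulr_ge0// divr_ge0// exprn_ge0// mulr_ge0.
move=> k; change (`|(k`!%:R)^-1 * (N *m M ^+ k) i j * t ^+ k| <=
  msum N * ((msum M * `|t|) ^+ k / k`!%:R)).
rewrite normrM normrM normfV normr_nat normrX exprMn.
rewrite [leRHS](_ : _ = (k`!%:R)^-1 * (msum N * msum M ^+ k) * `|t| ^+ k);
  last by ring.
rewrite ler_wpM2r ?exprn_ge0// ler_wpM2l ?invr_ge0//.
rewrite mxE (le_trans (ler_norm_sum _ _ _))//.
apply: (@le_trans _ _ (\sum_l `|N i l| * msum M ^+ k)).
  by apply: ler_sum => l _; rewrite normrM ler_wpM2l// norm_exp_mx_entry.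
rewrite -mulr_suml ler_wpM2r ?exprn_ge0//.
by rewrite /msum [leRHS](bigD1 i)//= lerDl sumr_ge0// => ? _; rewrite sumr_ge0.
Qed.

(** Matrix limits are entrywise, so each entry of the exponential is a real power series in [t],
    open to termwise differentiation. *)
Lemma cvg_expmx_entry M t i j :
  pseries (fun k => (k`!%:R)^-1 * (M ^+ k) i j) t k @[k --> \oo] -->
  expmx (t *: M) i j.
Proof.
pose L : 'M[R]_n := \matrix_(i, j)
  limn (pseries (fun k => (k`!%:R)^-1 * (M ^+ k) i j) t).
have cL i' j' :
    pseries (fun k => (k`!%:R)^-1 * (M ^+ k) i' j') t k @[k --> \oo] -->
      L i' j'.
  by rewrite mxE; have := @is_cvg_exp_mx_entry M 1%:M i' j' t;
    under eq_fun do rewrite mul1mx.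
suff -> : expmx (t *: M) = L by exact: cL.
rewrite /expmx; apply: (@cvg_lim _ _ _ _ _ (series _)) => //.
apply: cvg_mx => i' j'.
apply: cvg_trans (cL i' j'); apply: near_eq_cvg; near=> k.
rewrite /pseries /series/= summxE; apply: eq_bigr => l _.
by rewrite exp_mx_scale scalerA mxE; ring.
Unshelve. all: by end_near. Qed.

Lemma cvg_mul_expmx_entry M N t i j :
  pseries (fun k => (k`!%:R)^-1 * (N *m M ^+ k) i j) t k @[k --> \oo] -->
  (N *m expmx (t *: M)) i j.
Proof.
rewrite mxE.
have H : \sum_l N i l * pseries (fun k => (k`!%:R)^-1 * (M ^+ k) l j) t k
    @[k --> \oo] --> \sum_l N i l * expmx (t *: M) l j.
  by apply: cvg_sum => l; apply: cvgM; [exact: cvg_cst|exact: cvg_expmx_entry].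
apply: cvg_trans H; apply: near_eq_cvg; near=> k.
rewrite /pseries /series/=.
under eq_bigr do rewrite mulr_sumr.
rewrite exchange_big/=; apply: eq_bigr => r _.
by rewrite mxE mulr_sumr mulr_suml; apply: eq_bigr => l _; ring.
Unshelve. all: by end_near. Qed.

Lemma cvg_expmx_mul_entry M t i j :
  pseries (fun k => (k`!%:R)^-1 * (M ^+ k *m M) i j) t k @[k --> \oo] -->
  (expmx (t *: M) *m M) i j.
Proof.
rewrite mxE.
have H : \sum_l pseries (fun k => (k`!%:R)^-1 * (M ^+ k) i l) t k * M l j
    @[k --> \oo] --> \sum_l expmx (t *: M) i l * M l j.
  by apply: cvg_sum => l; apply: cvgM; [exact: cvg_expmx_entry|exact: cvg_cst].
apply: cvg_trans H; apply: near_eq_cvg; near=> k.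
rewrite /pseries /series/=.
under eq_bigr do rewrite mulr_suml.
rewrite exchange_big/=; apply: eq_bigr => r _.
by rewrite mxE mulr_sumr mulr_suml; apply: eq_bigr => l _; ring.
Unshelve. all: by end_near. Qed.

(** Both products are limits of power series with the same coefficients, since [M] commutes with its
    powers. *)
Lemma expmx_comm M t : M *m expmx (t *: M) = expmx (t *: M) *m M.
Proof.
apply/matrixP => i j.
have /cvg_lim <- // := @cvg_mul_expmx_entry M M t i j.
have /cvg_lim <- // := @cvg_expmx_mul_entry M t i j.
suff -> : (fun k => (k`!%:R)^-1 * (M *m M ^+ k) i j) =
          (fun k => (k`!%:R)^-1 * (M ^+ k *m M) i j :> R) by [].
by apply/funext => k; rewrite !mulmxE -exprS exprSr.
Qed.

Lemma expmx_scale0 M : expmx (0 *: M) = 1%:M.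
Proof.
rewrite scale0r /expmx; apply: cvg_lim => //; apply: cvg_near_cst.
(* The partial sum of index [0] is empty; all later ones reduce to the term of order zero. *)
exists 1%N => // -[//|k] _; rewrite /series/= big_mkord big_ord_recl/=.
rewrite fact0 invr1 scale1r expr0 big1 ?addr0// => i _.
by rewrite /bump/= add1n exprS -mulmxE mul0mx scaler0.
Qed.

Lemma is_derive_expmx M i j t :
  is_derive t (1 : R) (fun t => expmx (t *: M) i j) ((M *m expmx (t *: M)) i j).
Proof.
pose c k := (k`!%:R)^-1 * (M ^+ k) i j : R.
have E : (fun t => expmx (t *: M) i j) = (fun t => limn (pseries c t)).
  by apply/funext => x; apply/esym/cvg_lim => //; exact: cvg_expmx_entry.
(* Termwise differentiation replaces [N] by [N *m M]; starting from [1%:M], two applications cover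
   the first and second derivatives. *)
have dE (N : 'M[R]_n) :
    pseries_diffs (fun k => (k`!%:R)^-1 * (N *m M ^+ k) i j) =
    fun k => (k`!%:R)^-1 * (N *m M *m M ^+ k) i j.
  apply/funext => k; rewrite /pseries_diffs factS natrM invfM !mulrA.
  rewrite divff ?pnatr_eq0//.
  by rewrite mul1r exprS -mulmxE mulmxA.
have cE : c = (fun k => (k`!%:R)^-1 * (1%:M *m M ^+ k) i j).
  by apply/funext => k; rewrite mul1mx.
rewrite E.
have <- : limn (pseries (pseries_diffs c) t) = (M *m expmx (t *: M)) i j.
  by apply: cvg_lim => //; rewrite cE dE mul1mx; exact: cvg_mul_expmx_entry.
apply: (@pseries_snd_diffs _ _ (`|t| + 1)); rewrite ?cE ?dE;
  try exact: is_cvg_exp_mx_entry.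
by rewrite [ltRHS]ger0_norm ?ltrDl//; apply: addr_ge0.
Qed.

End matrix_exponential.

(** * Entrywise right derivatives of matrix functions, and the exponential semigroup *)

Section matrix_right_derivative.
Variable R : realType.

Definition mxrderiv (k l : nat) (F : R -> 'M[R]_(k, l)) t (L : 'M[R]_(k, l)) :=
  forall i j, rderiv (fun x => F x i j) t (L i j).

Definition mxcontinuous (k l : nat) (F : R -> 'M[R]_(k, l)) :=
  forall i j, continuous (fun x => F x i j).

Lemma mxrderiv_cst k l (M : 'M[R]_(k, l)) t : mxrderiv (fun=> M) t 0.
Proof. by move=> i j; rewrite mxE; exact: rderiv_cst. Qed.

Lemma mxrderivD k l (F G : R -> 'M[R]_(k, l)) t L K : mxrderiv F t L ->
  mxrderiv G t K -> mxrderiv (fun x => F x + G x) t (L + K).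
Proof.
move=> dF dG i j; rewrite mxE.
rewrite (_ : (fun x => _) = (fun x => F x i j + G x i j)); first exact: rderivD.
by apply/funext => x; rewrite mxE.
Qed.

Lemma mxrderivM k l r (F : R -> 'M[R]_(k, l)) (G : R -> 'M[R]_(l, r)) t L K :
  mxrderiv F t L -> mxrderiv G t K ->
  mxrderiv (fun x => F x *m G x) t (L *m G t + F t *m K).
Proof.
move=> dF dG i j.
rewrite (_ : (fun x => _) = (fun x => \sum_c F x i c * G x c j)); last first.
  by apply/funext => x; rewrite mxE.
have -> : (L *m G t + F t *m K) i j =
  \sum_c (L i c * G t c j + F t i c * K c j).
  by rewrite !mxE big_split.
by apply: rderiv_sum => c; exact: rderivM.
Qed.

Lemma mxrderivMl k l r (M : 'M[R]_(k, l)) (G : R -> 'M[R]_(l, r)) t K :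
  mxrderiv G t K -> mxrderiv (fun x => M *m G x) t (M *m K).
Proof.
by move=> dG; have := mxrderivM (mxrderiv_cst M t) dG; rewrite mul0mx add0r.
Qed.

Lemma mxrderivN k l (F : R -> 'M[R]_(k, l)) t L : mxrderiv F t L ->
  mxrderiv (fun x => - F x) t (- L).
Proof.
move=> dF i j; rewrite mxE.
rewrite (_ : (fun x => _) = (fun x => - F x i j)); first exact: rderivN.
by apply/funext => x; rewrite mxE.
Qed.

Lemma mxcontinuousD k l (F G : R -> 'M[R]_(k, l)) :
  mxcontinuous F -> mxcontinuous G -> mxcontinuous (fun x => F x + G x).
Proof.
move=> cF cG i j.
rewrite (_ : (fun x => _) = (fun x => F x i j + G x i j)).
  by move=> t; apply: cvgD; [exact: cF|exact: cG].
by apply/funext => x; rewrite mxE.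
Qed.

Lemma mxcontinuousN k l (F : R -> 'M[R]_(k, l)) :
  mxcontinuous F -> mxcontinuous (fun x => - F x).
Proof.
move=> cF i j; rewrite (_ : (fun x => _) = (fun x => - F x i j)).
  by move=> t; apply: cvgN; exact: cF.
by apply/funext => x; rewrite mxE.
Qed.

Lemma mxcontinuousM k l r (F : R -> 'M[R]_(k, l)) (G : R -> 'M[R]_(l, r)) :
  mxcontinuous F -> mxcontinuous G -> mxcontinuous (fun x => F x *m G x).
Proof.
move=> cF cG i j.
rewrite (_ : (fun x => _) = (fun x => \sum_c F x i c * G x c j)).
  by move=> t; apply: cvg_sum => c; apply: cvgM; [exact: cF|exact: cG].
by apply/funext => x; rewrite mxE.
Qed.

Lemma mxcontinuous_cst k l (M : 'M[R]_(k, l)) : mxcontinuous (fun=> M).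
Proof. by move=> i j t; exact: cvg_cst. Qed.

Lemma mxcontinuousMl k l r (M : 'M[R]_(k, l)) (G : R -> 'M[R]_(l, r)) :
  mxcontinuous G -> mxcontinuous (fun x => M *m G x).
Proof. by move=> cG; apply: mxcontinuousM => //; exact: mxcontinuous_cst. Qed.

Lemma mxrderiv_eq k l (F : R -> 'M[R]_(k, l)) a b : a <= b -> mxcontinuous F ->
  (forall t, a <= t < b -> mxrderiv F t 0) -> F b = F a.
Proof.
move=> ab cF dF; apply/matrixP => i j.
apply: (@rderiv_eq _ (fun x => F x i j)) => // t /dF/(_ i j).
by rewrite mxE.
Qed.

Variables (k : nat) (M : 'M[R]_k).

Lemma is_derive_expmx_fwd s t i j :
  is_derive t (1 : R) (fun u => expmx ((u - s) *: M) i j)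
    ((M *m expmx ((t - s) *: M)) i j).
Proof.
have := is_derive_expmx M i j (t - s) => H.
have H2 : is_derive t (1 : R) (fun u => u - s) 1.
  by have := is_deriveB (is_derive_id t (1 : R)) (is_derive_cst s t (1 : R));
    rewrite subr0.
have := @is_derive1_comp _ (fun t => expmx (t *: M) i j) (fun u => u - s) t _ _
  H H2.
by rewrite mulr1.
Qed.

Lemma is_derive_expmx_bwd s t i j :
  is_derive t (1 : R) (fun u => expmx ((s - u) *: M) i j)
    (- (M *m expmx ((s - t) *: M)) i j).
Proof.
have := is_derive_expmx M i j (s - t) => H.
have H2 : is_derive t (1 : R) (fun u => s - u) (- 1).
  by have := is_deriveB (is_derive_cst s t (1 : R)) (is_derive_id t (1 : R));
    rewrite sub0r.
have := @is_derive1_comp _ (fun t => expmx (t *: M) i j) (fun u => s - u) t _ _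
  H H2.
by rewrite mulrN1.
Qed.

Lemma mxrderiv_expmx_fwd s t :
  mxrderiv (fun u => expmx ((u - s) *: M)) t (M *m expmx ((t - s) *: M)).
Proof. by move=> i j; apply: is_derive_rderiv; exact: is_derive_expmx_fwd. Qed.

Lemma mxrderiv_expmx_bwd s t :
  mxrderiv (fun u => expmx ((s - u) *: M)) t (- (M *m expmx ((s - t) *: M))).
Proof.
by move=> i j; rewrite mxE; apply: is_derive_rderiv; exact: is_derive_expmx_bwd.
Qed.

Lemma mxcontinuous_expmx_fwd s : mxcontinuous (fun u => expmx ((u - s) *: M)).
Proof.
move=> i j t; apply: differentiable_continuous; apply/derivable1_diffP.
by have [] := is_derive_expmx_fwd s t i j.
Qed.

Lemma mxcontinuous_expmx_bwd s : mxcontinuous (fun u => expmx ((s - u) *: M)).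
Proof.
move=> i j t; apply: differentiable_continuous; apply/derivable1_diffP.
by have [] := is_derive_expmx_bwd s t i j.
Qed.

(** The product has zero right derivative in the middle time, because [M] commutes with its
    exponential; the middle time can thus be moved from [b] to [c]. *)
Lemma expmx_semigroup a b c :
  expmx ((a - b) *: M) *m expmx ((b - c) *: M) = expmx ((a - c) *: M).
Proof.
pose F u := expmx ((a - u) *: M) *m expmx ((u - c) *: M).
have H x y : x <= y -> F y = F x.
  move=> xy; apply: mxrderiv_eq => //.
    by apply: mxcontinuousM; [exact: mxcontinuous_expmx_bwd|exact:
      mxcontinuous_expmx_fwd].
  move=> t _; have := mxrderivM (@mxrderiv_expmx_bwd a t)
    (@mxrderiv_expmx_fwd c t).
  by rewrite mulNmx mulmxA -expmx_comm addNr.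
have -> : expmx ((a - c) *: M) = F c by rewrite /F subrr expmx_scale0 mulmx1.
by have [bc|cb] := leP b c; [rewrite (H _ _ bc)|rewrite -(H _ _ (ltW cb))].
Qed.

End matrix_right_derivative.

(** * Paths of the state process *)

Section state_paths.
Variable R : realType.
Let mu := @lebesgue_measure R.

(** The integral of [N u *m l u] over [[s, t]], with the sum outside so that only scalar integrals
    occur. *)
Definition mxprimitive (k m : nat) (N : R -> 'M[R]_(k, m)) (l : R -> 'cV[R]_m)
    (s t : R) : 'cV[R]_k :=
  \col_a \sum_b \int[mu]_(u in `[s, t]) (N u a b * l u b ord0).

Section mxprimitive.
Variables (k m : nat) (N : R -> 'M[R]_(k, m)) (l : R -> 'cV[R]_m) (s : R).
Hypothesis rN : forall a b, rcont_locbounded (fun u => N u a b).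
Hypothesis rl : forall b, rcont_locbounded (fun u => l u b ord0).

Lemma mxprimitive_continuous : mxcontinuous (mxprimitive N l s).
Proof.
move=> a j; rewrite (_ : (fun x => _) =
  (fun t => \sum_b \int[mu]_(u in `[s, t]) (N u a b * l u b ord0))); last first.
  by apply/funext => t; rewrite mxE.
by move=> t; apply: cvg_sum => b; apply: Rintegral_primitive_continuous;
  exact: rclbM.
Qed.

Lemma mxprimitive_rderiv t : s <= t ->
  mxrderiv (mxprimitive N l s) t (N t *m l t).
Proof.
move=> st a j; rewrite (_ : (fun x => _) =
  (fun t => \sum_b \int[mu]_(u in `[s, t]) (N u a b * l u b ord0))); last first.
  by apply/funext => x; rewrite mxE.
rewrite mxE (ord1 j); apply: rderiv_sum => b.
by apply: (@Rintegral_primitive_rderiv _ (fun u => N u a b * l u b ord0)) => //;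
  exact: rclbM.
Qed.

Lemma mxprimitive0 : mxprimitive N l s s = 0.
Proof.
apply/colP => a; rewrite !mxE big1// => b _.
by rewrite set_itv1 Rintegral_set1.
Qed.

End mxprimitive.

Variables (k m : nat) (M : 'M[R]_k) (E : 'M[R]_(k, m)).

(** For [z = x - E l] the state equation reads [z' = M z + M E l]. This is the integral in its
    variation-of-constants formula, after [expmx ((t - s) *: M)] is factored out. *)
Definition forcing (l : R -> 'cV[R]_m) (s : R) : R -> 'cV[R]_k :=
  mxprimitive (fun u => expmx ((s - u) *: M) *m (M *m E)) l s.

Lemma rclb_mx_continuous (p q : nat) (F : R -> 'M[R]_(p, q)) : mxcontinuous F ->
  forall i j, rcont_locbounded (fun u => F u i j).
Proof. by move=> cF i j; exact/continuous_rclb/cF. Qed.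

Lemma expmx_bwd_mul_continuous t (p : nat) (N : 'M[R]_(k, p)) :
  mxcontinuous (fun u => expmx ((t - u) *: M) *m N).
Proof.
by apply: mxcontinuousM; [exact: mxcontinuous_expmx_bwd|exact:
  mxcontinuous_cst].
Qed.

Section one_path.
Variable l : R -> 'cV[R]_m.
Hypothesis rl : forall b, rcont_locbounded (fun u => l u b ord0).

Lemma forcing_continuous s : mxcontinuous (forcing l s).
Proof.
apply: mxprimitive_continuous => //; apply: rclb_mx_continuous.
exact: expmx_bwd_mul_continuous.
Qed.

Lemma forcing_rderiv s t : s <= t ->
  mxrderiv (forcing l s) t (expmx ((s - t) *: M) *m (M *m E) *m l t).
Proof.
apply: mxprimitive_rderiv => //; apply: rclb_mx_continuous.
exact: expmx_bwd_mul_continuous.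
Qed.

(** Entrywise this is [cvg_Stieltjes_sum] for [f x = expmx ((t - x) *: M) *m E]; the remaining
    integral of [f' l] is then expressed by [forcing]. *)
Lemma cvg_state_sum s t a : s < t ->
  let u (n i : nat) := s + (t - s) / n.+1%:R * i%:R in
  (\sum_(i < n.+1)
     expmx ((t - u n i) *: M) *m E *m (l (u n i.+1) - l (u n i))) a ord0
    @[n --> \oo] -->
  (E *m l t - expmx ((t - s) *: M) *m (E *m l s)
     + expmx ((t - s) *: M) *m forcing l s t) a ord0.
Proof.
move=> st u.
pose f x := expmx ((t - x) *: M) *m E.
pose f' x := - (M *m expmx ((t - x) *: M)) *m E.
have cf : mxcontinuous f by exact: expmx_bwd_mul_continuous.
have cf' : mxcontinuous f'.
  apply: mxcontinuousM; last exact: mxcontinuous_cst.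
  by apply/mxcontinuousN/mxcontinuousMl; exact: mxcontinuous_expmx_bwd.
have df x : mxrderiv f x (f' x).
  have := mxrderivM (@mxrderiv_expmx_bwd _ _ M t x) (mxrderiv_cst E x).
  by rewrite mulmx0 addr0.
have rf' := rclb_mx_continuous cf'.
(* The right derivatives of the two summands cancel by [expmx_semigroup], so [G] stays at its
   initial value [0]. *)
pose G x := expmx ((t - s) *: M) *m forcing l s x + mxprimitive f' l s x.
have G0 : G s = 0 by rewrite /G /forcing !mxprimitive0 mulmx0 addr0.
have Gt : G t = 0.
  rewrite -G0; apply: mxrderiv_eq; first exact: ltW.
    apply: mxcontinuousD; last exact: mxprimitive_continuous.
    by apply: mxcontinuousMl; exact: forcing_continuous.
  move=> x /andP[sx xt].
  have := mxrderivD (mxrderivMl (M := expmx ((t - s) *: M)) (forcing_rderiv sx))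
                    (mxprimitive_rderiv rf' rl sx).
  by rewrite /f' !mulmxA expmx_semigroup !mulNmx -expmx_comm subrr.
have -> : E *m l t - expmx ((t - s) *: M) *m (E *m l s)
     + expmx ((t - s) *: M) *m forcing l s t =
       f t *m l t - f s *m l s - mxprimitive f' l s t.
  have -> : expmx ((t - s) *: M) *m forcing l s t = - mxprimitive f' l s t.
    by apply/eqP; rewrite -addr_eq0; apply/eqP.
  by rewrite /f subrr expmx_scale0 mul1mx mulmxA.
have -> : (f t *m l t - f s *m l s - mxprimitive f' l s t) a ord0 =
    \sum_b (f t a b * l t b ord0 - f s a b * l s b ord0
      - \int[mu]_(u in `[s, t]) (f' u a b * l u b ord0)).
  by rewrite !mxE !sumrB.
rewrite (_ : (fun n => _) = (fun n => \sum_b \sum_(i < n.+1)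
   f (u n i) a b * (l (u n i.+1) b ord0 - l (u n i) b ord0))); last first.
  apply/funext => n; rewrite summxE exchange_big/=; apply: eq_bigr => i _.
  by rewrite mxE; apply: eq_bigr => b _; rewrite !mxE.
apply: cvg_sum => b.
exact: (cvg_Stieltjes_sum st (cf a b) (fun x => df x a b) (rf' a b) (rl b)).
Qed.

Lemma right_cvg_rat_eq0 (g : R -> R) t : g x @[x --> t^'+] --> g t ->
  (forall r : rat, t < ratr r -> g (ratr r) = 0) -> g t = 0.
Proof.
move=> gt g0; apply: contrapT => /eqP gt0.
have /cvgrPdist_lt/(_ `|g t|) := gt; rewrite normr_gt0 => /(_ gt0)[e /= e0 he].
have [r] := @rat_in_itvoo _ t (t + e) ltac:(lra).
rewrite in_itv/= => /andP[tr re].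
have := he (ratr r).
rewrite /ball_/= g0// subr0 ltxx distrC ger0_norm ?subr_ge0 ?ltW//.
by move=> /(_ ltac:(lra) tr).
Qed.

(* With [z := x - E l] the hypothesis reads
[z t = expmx ((t - s) *: M) *m (z s + forcing l s t)], where the first factor
solves the homogeneous equation and [forcing] has an explicit right
derivative. *)
Lemma state_path_rderiv (x : R -> 'cV[R]_k) :
  (forall a, rcont_locbounded (fun u => x u a ord0)) ->
  (forall (n : nat) (r : rat), - n%:R < (ratr r : R) ->
     x (ratr r) = expmx ((ratr r - (- n%:R)) *: M) *m x (- n%:R) +
      (E *m l (ratr r) - expmx ((ratr r - (- n%:R)) *: M) *m (E *m l (- n%:R))
     + expmx ((ratr r - (- n%:R)) *: M) *m forcing l (- n%:R) (ratr r))) ->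
  mxcontinuous (fun t => x t - E *m l t) /\
  forall t, mxrderiv (fun t => x t - E *m l t) t (M *m x t).
Proof.
move=> rx hx; pose z t := x t - E *m l t.
have rz : forall a j, rcont_locbounded (fun u => z u a j).
  move=> a j; rewrite (_ : (fun u => _) =
     (fun u => x u a ord0 + \sum_b (- E a b) * l u b ord0)); last first.
    apply/funext => u; rewrite (ord1 j) !mxE -sumrN; congr (_ + _).
    by apply: eq_bigr => b _; rewrite mulNr.
  apply: rclbD => //; apply: rclb_sum => b; apply: rclbM => //; exact: rclb_cst.
pose g (n : nat) t := expmx ((t - (- n%:R)) *: M) *m
  (z (- n%:R) + forcing l (- n%:R) t).
have cg n : mxcontinuous (g n).
  apply: mxcontinuousM; first exact: mxcontinuous_expmx_fwd.
  by apply: mxcontinuousD; [exact: mxcontinuous_cst|exact: forcing_continuous].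
(* Both sides are right continuous and agree at the rationals to the right of [t]. *)
have zg (n : nat) (t : R) : - n%:R <= t -> z t = g n t.
  move=> nt; apply/matrixP => a j; apply/eqP; rewrite -subr_eq0; apply/eqP.
  apply: (@right_cvg_rat_eq0 (fun t => z t a j - g n t a j)).
    apply: cvgB; first exact: (rz a j).1.
    by apply: cvg_at_right_filter; exact: cg.
  move=> r tr; have nr : - n%:R < (ratr r : R) by exact: le_lt_trans tr.
  apply/eqP; rewrite subr_eq0; apply/eqP; congr fun_of_matrix.
  rewrite /z (hx n r nr) /g mulmxDr mulmxBr.
  by rewrite -!addrA; congr (_ + _); rewrite [LHS]addrC !addrA subrK.
(* The countably many start times [- n%:R] reach below every [t]. *)
have big (t : R) : exists n : nat, - n%:R < t.
  by exists (Num.truncn (- t)).+1; have := truncnS_gt (- t); lra.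
split=> [a j t|t].
  have [n nt] := big t.
  have nz : \forall y \near t, z y a j = g n y a j.
    near=> y; rewrite (zg n)//; apply: ltW; near: y; exact: (cvgr_gt t).
  rewrite -/z /continuous_at.
  have -> : z t a j = g n t a j by rewrite (zg n)// ltW.
  have := cg n a j t; apply: cvg_trans; apply: near_eq_cvg.
  by apply: filterS nz => y ->.
have [n nt] := big t.
(* The product rule gives [M z + M E l], which is [M x]. *)
have dg : mxrderiv (g n) t (M *m x t).
  have dF := mxrderivD (mxrderiv_cst (z (- n%:R)) t) (forcing_rderiv (ltW nt)).
  have := mxrderivM (@mxrderiv_expmx_fwd _ _ M (- n%:R) t) dF.
  rewrite add0r -mulmxA -/(g n t) -zg ?(ltW nt)//.
  rewrite !mulmxA expmx_semigroup subrr expmx_scale0 mul1mx /z mulmxBr mulmxA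
    subrK.
  exact.
move=> a j; apply: rderiv_near (dg a j); last by rewrite -/(z t) (zg n)// ltW.
near=> h; rewrite -/(z (h + t)) (zg n)//.
have h0 : 0 < h by near: h; exact: nbhs_right_gt.
lra.
Unshelve. all: by end_near. Qed.

End one_path.
End state_paths.

Lemma cadlag_entry_rclb (R : realType) (k : nat) (f : R -> 'cV[R]_k) a :
  cadlag f -> rcont_locbounded (fun x => f x a ord0).
Proof.
move=> cf; apply: cadlag_rclb => t; have [fr /cvg_ex[L fl]] := cf t.
split; first exact: (cvg_comp _ _ fr (@coord_continuous R k 1 a ord0 (f t))).
apply/cvg_ex; exists (L a ord0).
exact: (cvg_comp _ _ fl (@coord_continuous R k 1 a ord0 L)).
Qed.

(** * From limits in probability to almost sure identities *)

Section almost_sure.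
Context (dsp : measure_display) (Omega : measurableType dsp) (R : realType).
Variable P : probability Omega R.

Lemma ae_forall_rat (Q : rat -> Omega -> Prop) :
  (forall r, {ae P, forall w, Q r w}) -> {ae P, forall w, forall r, Q r w}.
Proof.
move=> hQ.
have : {ae P, forall w, forall n, if unpickle n is Some r then Q r w else True}.
  apply: ae_foralln => n; case: (unpickle n) => [r|]; first exact: hQ.
  exact: aeW.
by apply: filterS => w hw r; have := hw (pickle r); rewrite pickleK.
Qed.

Lemma random_vector_entry (k : nat) (Z : Omega -> 'cV[R]_k) a :
  random_vector Z -> measurable_fun [set: Omega] (fun w => Z w a ord0).
Proof.
move=> mZ mD; apply: (measurability _ (RGenOInfty.measurableE R)) => //.
move=> _ [_ [x ->] <-]; rewrite setTI.
apply: (mZ [set v | v a ord0 \in `]x, +oo[]).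
apply: sub_sigma_algebra.
rewrite [X in open X](_ : _ =
  (fun v : 'cV[R]_k => v a ord0) @^-1` [set y | x < y]).
  by apply: open_comp; [move=> v _; exact: coord_continuous|exact: open_gt].
by apply/seteqP; split=> v /=; rewrite in_itv/= andbT.
Qed.

Lemma mx_norm_le (k l : nat) (v : 'M[R]_(k, l)) (e : R) : 0 <= e ->
  `|v| <= e <-> forall i j, `|v i j| <= e.
Proof.
move=> e0; rewrite /Num.Def.normr /= mx_normrE;
  split=> [/bigmax_leP[_ h] i j|h].
  exact: (h (i, j)).
by apply/bigmax_leP; split => // -[i j] _; exact: h.
Qed.

Lemma measurable_mx_norm_gt (k : nat) (v : Omega -> 'cV[R]_k) (e : R) :
  0 <= e ->
  (forall a, measurable_fun [set: Omega] (fun w => v w a ord0)) ->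
  measurable [set w | e < `|v w|].
Proof.
move=> e0 mv.
rewrite (_ : mkset _ = \bigcup_(a : 'I_k) [set w | e < `|v w a ord0|]).
  apply: countable_bigcupT_measurable => // a.
  rewrite -[mkset _]setTI.
  have -> : mkset (fun w => e < `|v w a ord0|) =
     (fun w => `|v w a ord0|) @^-1` `]e, +oo[%classic.
    by apply/seteqP; split=> w /=; rewrite in_itv/= andbT.
  exact: (measurableT_comp (@normr_measurable R setT) (mv a)).
apply/seteqP; split=> w /=.
  apply: contraPP => h; apply/negP; rewrite -leNgt; apply/mx_norm_le => // a j.
  rewrite (ord1 j) leNgt; apply/negP => hv; apply: h; exists a => //.
case=> a _ /= ha; apply: contraPT ha; rewrite -!leNgt => /(mx_norm_le _ e0) H.
by apply/negP; rewrite -leNgt.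
Qed.

(** The intersection of [A k n] over [n >= N] is smaller than each of its members, whose
    probabilities become arbitrarily small; it is therefore a null set. Unlike a Borel-Cantelli
    argument, this requires no summability. *)
Lemma ae_infinitely_often_not (A : nat -> nat -> set Omega) :
  (forall k n, measurable (A k n)) ->
  (forall k (eta : R), 0 < eta ->
    exists N, forall n, (N <= n)%N -> (P (A k n) < eta%:E)%E) ->
  {ae P, forall w, forall k N, exists2 n, (N <= n)%N & ~ A k n w}.
Proof.
move=> mA hA; apply: ae_foralln => k; apply: ae_foralln => N.
exists (\bigcap_(n in [set n | (N <= n)%N]) A k n); split.
- by apply: bigcap_measurable => //; exists N => /=.
- apply/eqP; rewrite eq_le measure_ge0 andbT.
  apply/lee_addgt0Pr => eta eta0; rewrite add0e.
  have [N' hN'] := hA k eta eta0.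
  apply: ltW; apply: le_lt_trans (hN' (maxn N N') (leq_maxr _ _)).
  apply: le_measure; rewrite ?inE//.
    by apply: bigcap_measurable => //; exists N => /=.
  by move=> w; apply; rewrite /= leq_maxl.
- move=> w /= h n /= Nn; apply: contrapT => An; apply: h; by exists n.
Qed.

(** Along uniform partitions the sums converge to [I] in probability, hence almost surely come close
    to [I] infinitely often; as they also converge to [J] pathwise, the two limits agree. *)
Lemma stoch_integral_ae_eq (k m : nat) (f : R -> 'M[R]_(k, m))
    (L : R -> Omega -> 'cV[R]_m) (s t : R) (I J : Omega -> 'cV[R]_k) :
  s < t -> (forall t, random_vector (L t)) -> stoch_integral P f L s t I ->
  let u (n i : nat) := s + (t - s) / n.+1%:R * i%:R in
  {ae P, forall w, forall a,
    (\sum_(i < n.+1) f (u n i) *m (L (u n i.+1) w - L (u n i) w)) a ord0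
      @[n --> \oo] --> J w a ord0} ->
  {ae P, forall w, I w = J w}.
Proof.
move=> st mL [mI hI] u hJ.
pose S n w := \sum_(i < n.+1) f (u n i) *m (L (u n i.+1) w - L (u n i) w).
pose A k' n := [set w | k'.+1%:R^-1 < `|S n w - I w|].
have mA k' n : measurable (A k' n).
  apply: (@measurable_mx_norm_gt _ (fun w => S n w - I w)) => // a.
  rewrite (_ : (fun w => _) = (fun w => \sum_(i < n.+1) \sum_b
    f (u n i) a b * (L (u n i.+1) w b ord0 - L (u n i) w b ord0) - I w a ord0)).
    apply: measurable_funB; last exact: random_vector_entry.
    apply: measurable_sum => i; apply: measurable_sum => b.
    apply: measurable_funM; first exact: measurable_cst.
    by apply: measurable_funB; exact: random_vector_entry.
  apply/funext => w; rewrite !mxE /S summxE; congr (_ - _).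
  apply: eq_bigr => i _; rewrite mxE; apply: eq_bigr => b _.
  by rewrite !mxE.
have hA k' (eta : R) : 0 < eta ->
    exists N, forall n, (N <= n)%N -> (P (A k' n) < eta%:E)%E.
  move=> eta0.
  have [//|delta d0 hd] := hI k'.+1%:R^-1 eta _ eta0.
  (* From this index on, the mesh [(t - s) / n.+1] is below [delta]. *)
  pose N := Num.truncn ((t - s) / delta).
  exists N => n Nn; apply: hd.
  - by rewrite /u mulr0 addr0.
  - by rewrite /u divfK ?pnatr_eq0// addrC subrK.
  move=> i _; have -> : u n i.+1 - u n i = (t - s) / n.+1%:R.
    by rewrite /u -(@natr1 R i); ring.
  rewrite divr_gt0 ?subr_gt0//=.
  have h1 : (t - s) / delta < n.+1%:R.
    by apply: lt_le_trans (truncnS_gt _) _; rewrite ler_nat.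
  by rewrite ltr_pdivrMr// mulrC -ltr_pdivrMr.
have := ae_infinitely_often_not mA hA.
apply: filterS2 hJ => w cJ iJ.
apply/colP => a; apply/eqP; rewrite -subr_eq0 -normr_le0.
apply/ler_addgt0Pr => e e0; rewrite add0r.
have /cvgrPdist_lt/(_ (e / 2)) := cJ a; rewrite divr_gt0// => /(_ isT)[N _ hN].
have [k' hk] : exists k', k'.+1%:R^-1 < e / 2.
  exists (Num.truncn (e / 2)^-1); rewrite invf_plt ?posrE ?divr_gt0//.
  exact: truncnS_gt.
(* At this [n] the sum is within [e / 2] of both [I w] and [J w]. *)
have [n Nn /negP] := iJ k' N; rewrite /A/= -leNgt => /mx_norm_le;
  rewrite invr_ge0 ler0n.
move=> /(_ isT a ord0); rewrite !mxE => h1.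
have h2 := hN n Nn; rewrite /= -/(S n w) in h2.
have := ler_distD (S n w a ord0) (I w a ord0) (J w a ord0).
rewrite distrC in h2; rewrite distrC in h1.
by move=> /le_trans; apply;
  rewrite [leRHS]splitr lerD ?(ltW h2) ?(le_trans h1 (ltW hk)).
Qed.

(** The state equation is used only from times [- n] to rational times. These pairs are countable,
    so one null set serves for all of them, and [state_path_rderiv] extends the conclusion to all
    times. *)
Lemma state_process_paths (k m : nat) (M : 'M[R]_k) (E : 'M[R]_(k, m))
    (L : R -> Omega -> 'cV[R]_m) (X : R -> Omega -> 'cV[R]_k) :
  levy_process P L -> state_process P M E L X ->
  {ae P, forall w, [/\ forall a, rcont_locbounded (fun t => X t w a ord0),
    mxcontinuous (fun t => X t w - E *m L t w) &
    forall t, mxrderiv (fun t => X t w - E *m L t w) t (M *m X t w)]}.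
Proof.
move=> hL hX.
have cL := levy_cadlag hL; have cX := state_cadlag hX.
have H : {ae P, forall w, forall (n : nat) (r : rat), - n%:R < (ratr r : R) ->
     X (ratr r) w = expmx ((ratr r - (- n%:R)) *: M) *m X (- n%:R) w +
      (E *m L (ratr r) w - expmx ((ratr r - (- n%:R)) *: M) *m
        (E *m L (- n%:R) w)
     + expmx ((ratr r - (- n%:R)) *: M) *m forcing M E (L ^~ w) (- n%:R)
       (ratr r))}.
  apply: ae_foralln => n; apply: ae_forall_rat => r.
  have [nr|nr] := pselect (- n%:R < (ratr r : R)); last by apply: aeW => w /nr.
  have [I hI hXI] := state_eq hX nr.
  have /= := stoch_integral_ae_eq (J := fun w =>
     E *m L (ratr r) w - expmx ((ratr r - (- n%:R)) *: M) *m (E *m L (- n%:R) w)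
     + expmx ((ratr r - (- n%:R)) *: M) *m forcing M E (L ^~ w) (- n%:R)
       (ratr r))
     nr (levy_random hL) hI.
  move=> HI; have {}HI : {ae P, forall w, I w = _} := HI _.
  apply: filterS2 hXI (HI _) => [w -> -> //|].
  apply: filterS cL => w cLw a.
  by apply: cvg_state_sum => // b; exact: cadlag_entry_rclb.
apply: filterS3 cL cX H => w cLw cXw Hw.
have rX a : rcont_locbounded (fun t => X t w a ord0).
  exact: (@cadlag_entry_rclb _ _ (X ^~ w)).
have rL b : rcont_locbounded (fun t => L t w b ord0).
  exact: (@cadlag_entry_rclb _ _ (L ^~ w)).
have [? ?] := @state_path_rderiv _ _ _ M E (L ^~ w) rL (X ^~ w) rX Hw.
by split.
Qed.

End almost_sure.

(** * Companion matrices acting on stacked blocks *)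

Section block_algebra.
Variable R : realType.

(** Blocks come from a sequence on [nat], so shifted vectors such as [fun i => c (k + i)] need no
    bound proofs. *)
Definition stack (p m r : nat) (c : nat -> 'M[R]_(m, r)) :
    'M[R]_(\sum_(i < p) m, r) :=
  \mxcol_(i < p) c i.

(* Zero for [p <= j]. *)
Definition block_proj (p m : nat) (j : nat) : 'M[R]_(m, \sum_(i < p) m) :=
  if insub j is Some i then submxcol 1%:M (i : 'I_p) else 0.

(** Written as a matrix product, so that continuity and right derivatives pass to blocks by
    linearity. *)
Definition block (p m r : nat) (v : 'M[R]_(\sum_(i < p) m, r)) (j : nat) :
    'M[R]_(m, r) :=
  block_proj p m j *m v.

Lemma eq_stack p m r (c c' : nat -> 'M[R]_(m, r)) :
  (forall i, (i < p)%N -> c i = c' i) -> stack p c = stack p c'.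
Proof. by move=> cc'; apply/eq_mxcolP => i; exact: cc'. Qed.

Lemma stackD p m r (c c' : nat -> 'M[R]_(m, r)) :
  stack p c + stack p c' = stack p (fun i => c i + c' i).
Proof. by rewrite /stack mxcolD. Qed.

Lemma blockE p m r (v : 'M[R]_(\sum_(i < p) m, r)) (i : 'I_p) :
  block v i = submxcol v i.
Proof. by rewrite /block /block_proj valK submxcol_mul mul1mx. Qed.

Lemma block_stack p m r (c : nat -> 'M[R]_(m, r)) j : (j < p)%N ->
  block (stack p c) j = c j.
Proof. by move=> jp; rewrite (blockE _ (Ordinal jp)) mxcolK. Qed.

Lemma stack_block p m r (v : 'M[R]_(\sum_(i < p) m, r)) : stack p (block v) = v.
Proof. by rewrite -[RHS]submxcolK; apply/eq_mxcolP => i; rewrite blockE. Qed.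

Lemma companion_stack p m r (C : nat -> 'M[R]_m) (c : nat -> 'M[R]_(m, r)) :
  companion (fun j : 'I_p => C j) *m stack p c =
  stack p (fun i => if i.+1 == p then \sum_(j < p) C j *m c j else c i.+1).
Proof.
rewrite /companion /stack mul_mxblock_mxrow; apply/eq_mxcolP => i.
case: eqP => [//|ip].
have ip' : (i.+1 < p)%N by rewrite ltn_neqAle ltn_ord andbT; apply/eqP.
rewrite (bigD1 (Ordinal ip'))//= eqxx mul1mx big1 ?addr0// => j ji.
case: eqP => [jE|_]; last by rewrite mul0mx.
by move: ji; rewrite -val_eqE/= jE eqxx.
Qed.

Lemma last_block_colM p m d r (K : 'M[R]_(m, d)) (v : 'M[R]_(d, r)) :
  last_block_col p K *m v = stack p (fun i => if i.+1 == p then K *m v else 0).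
Proof.
rewrite /last_block_col mxcol_mul; apply/eq_mxcolP => i.
by case: eqP => // _; rewrite mul0mx.
Qed.

Lemma last_block_rowM q m r (c : nat -> 'M[R]_(m, r)) : (0 < q)%N ->
  last_block_row R q m *m stack q c = c q.-1.
Proof.
move=> q0; rewrite /last_block_row /stack mul_mxrow_mxcol.
have qq : (q.-1 < q)%N by rewrite prednK.
rewrite (bigD1 (Ordinal qq))//= prednK// eqxx mul1mx big1 ?addr0// => j ji.
case: eqP => [jE|_]; last by rewrite mul0mx.
by case/eqP: ji; apply: val_inj => /=; move/(congr1 predn): jE.
Qed.

Lemma first_blocksE m p q (hqp : (q <= p)%N) (v : 'cV[R]_(\sum_(i < p) m)) :
  first_blocks hqp v = stack q (block v).
Proof. by apply/eq_mxcolP => i; rewrite -blockE. Qed.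

Lemma rV_gram_eq0 d (y : 'rV[R]_d) : y *m y^T = 0 -> y = 0.
Proof.
move/matrixP/(_ ord0 ord0); rewrite !mxE => /eqP.
rewrite psumr_eq0 => [/allP H|i _]; last by rewrite !mxE -expr2 sqr_ge0.
apply/rowP => j; have := H j (mem_index_enum j).
by rewrite !mxE /= -expr2 sqrf_eq0 => /eqP.
Qed.

(** If [v B^T B = 0] then [v B^T] has zero Gram product, hence vanishes, and [v = 0] because the
    rows of [B^T] are independent. *)
Lemma gram_unitmx d m (B : 'M[R]_(d, m)) : \rank B = m -> B^T *m B \in unitmx.
Proof.
move=> rB; rewrite -row_free_unit; apply: inj_row_free => v vB.
have freeBT : row_free B^T by rewrite /row_free mxrank_tr rB.
apply/eqP; rewrite -(mulmx_free_eq0 _ freeBT); apply/eqP/rV_gram_eq0.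
by rewrite trmx_mul trmxK mulmxA -(mulmxA v) vB mul0mx.
Qed.

(** * The shift recursion driven by [calB], and the inverse of [calB] *)

Section coefficients.
Variables (m d p q : nat) (A : nat -> 'M[R]_m) (B : nat -> 'M[R]_(d, m)).
Hypotheses (qp : (q < p)%N) (q0 : (0 < q)%N).
Hypothesis hBq : \rank (B q) = m.

Local Notation Bq1 := (left_inv (B q)).
Local Notation cB := (calB q B).
Local Notation E := (calE q B).
Local Notation S := (last_block_row R q m).

Lemma left_invK : Bq1 *m B q = 1%:M.
Proof. by rewrite /left_inv -mulmxA mulVmx// gram_unitmx. Qed.

Lemma boldA_stack r (c : nat -> 'M[R]_(m, r)) : boldA p A *m stack p c =
  stack p (fun i =>
    if i.+1 == p then - \sum_(j < p) A (p - j)%N *m c j else c i.+1).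
Proof.
rewrite /boldA (@companion_stack p m r (fun j => - A (p - j)%N)).
apply: eq_stack => i _; case: eqP => // _.
by rewrite -sumrN; apply: eq_bigr => j _; rewrite mulNmx.
Qed.

Lemma calB_stack r (c : nat -> 'M[R]_(m, r)) : cB *m stack q c =
  stack q (fun i =>
    if i.+1 == q then - \sum_(j < q) Bq1 *m B j *m c j else c i.+1).
Proof.
rewrite /calB (@companion_stack q m r (fun j => - (Bq1 *m B j))).
apply: eq_stack => i _; case: eqP => // _.
by rewrite -sumrN; apply: eq_bigr => j _; rewrite mulNmx.
Qed.

Lemma underB_stack r (c : nat -> 'M[R]_(m, r)) :
  underB p q B *m stack p c = \sum_(j < q.+1) B j *m c j.
Proof.
rewrite /underB /stack mul_mxrow_mxcol.
rewrite (big_ord_widen_cond _ xpredT (fun j => B j *m c j) qp)/=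
  [RHS]big_mkcond/=.
by apply: eq_bigr => j _; rewrite ltnS; case: leqP => // _; rewrite mul0mx.
Qed.

Lemma underA_stack r (c : nat -> 'M[R]_(m, r)) :
  underA p q A *m stack q c = \sum_(j < q) A (p - j)%N *m c j.
Proof. by rewrite /underA /stack mul_mxrow_mxcol. Qed.

Section recursion.
Variables (r : nat) (c : nat -> 'M[R]_(m, r)).
Let xi k := stack q (fun i => c (k + i)%N).
Let D k := \sum_(j < q.+1) B j *m c (k + j)%N.

(** Only the last block is not a plain shift. There [left_invK] isolates [c (k + q)] in
    [Bq1 *m D k], and the last row of [calB] cancels the other terms. *)
Lemma stack_shift k : xi k.+1 = cB *m xi k + E *m D k.
Proof.
rewrite /xi calB_stack /calE last_block_colM stackD; apply: eq_stack => i _.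
case: eqP => [iq|_]; last by rewrite addr0 addSnnS.
rewrite /D big_ord_recr/= mulmxDr mulmxA left_invK mul1mx addSnnS iq.
rewrite mulmx_sumr addrA -[LHS]add0r; congr (_ + _).
by apply/esym/eqP; rewrite addrC subr_eq0; apply/eqP/eq_bigr => j _;
  rewrite mulmxA.
Qed.

Lemma stack_shift_iter k :
  xi k = cB ^+ k *m xi 0%N + \sum_(0 <= i < k) cB ^+ (k - 1 - i) *m E *m D i.
Proof.
elim: k => [|k IH]; first by rewrite big_geq// addr0 expr0 mul1mx.
rewrite stack_shift IH mulmxDr mulmxA mulmxE -exprS -addrA; congr (_ + _).
have kk : (k.+1 - 1 - k = 0)%N by lia.
rewrite big_nat_recr//= kk expr0 mul1mx; congr (_ + _).
rewrite mulmx_sumr; apply: eq_big_nat => i /andP[_ ik].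
rewrite !mulmxA mulmxE -exprS; congr (cB ^+ _ *m _ *m _).
lia.
Qed.

(** [S] reads off the last block of [xi k], which is [c (k + q.-1)]. *)
Lemma entry_shift_iter k : c (k + q.-1)%N =
  S *m cB ^+ k *m xi 0%N + \sum_(0 <= i < k) S *m cB ^+ (k - 1 - i) *m E *m D i.
Proof.
have := last_block_rowM (fun i => c (k + i)%N) q0; rewrite -/(xi k) => <-.
rewrite stack_shift_iter mulmxDr mulmxA; congr (_ + _).
by rewrite mulmx_sumr; apply: eq_bigr => i _; rewrite !mulmxA.
Qed.

(** Every block on the left has index at least [q.-1], so [entry_shift_iter] applies to it;
    exchanging the double sum collects the coefficient of each [D nu]. *)
Lemma increment_identity : (0 < p - q)%N ->
  c p.-1 +
    \sum_(1 <= k < (p - q).+1) A (p - q - k + 1)%N *m c (k - 1 + q.-1)%N =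
  \sum_(0 <= nu < p - q)
        (S *m cB ^+ (p - q - 1 - nu) *m E
         + \sum_(nu <= k < p - q - 1)
             A (p - q - k - 1)%N *m S *m cB ^+ (k - nu) *m E) *m D nu
  + (\sum_(1 <= k < (p - q).+1) A (p - q - k + 1)%N *m S *m cB ^+ (k - 1)
         + S *m cB ^+ (p - q)) *m xi 0%N.
Proof.
move=> pq0.
have -> : p.-1 = (p - q + q.-1)%N by rewrite -!subn1 addnBA// subnK// ltnW.
rewrite entry_shift_iter.
under [X in _ + X = _]eq_bigr do
  rewrite entry_shift_iter mulmxDr !mulmxA mulmx_sumr.
rewrite big_split/= -mulmx_suml mulmxDl addrACA [LHS]addrC
  (addrC (S *m _ *m _)); congr (_ + _).
under [RHS]eq_bigr do rewrite mulmxDl mulmx_suml.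
rewrite big_split/=; congr (_ + _).
(* The first term has an empty inner sum. After it is dropped, [k] stands for the former [k + 2],
   and the inner sum runs over [nu <= k]. *)
rewrite big_add1/= -{1}(prednK pq0) big_nat_recl//= big_geq// add0r -subn1.
rewrite (eq_big_nat _ _ (F2 := fun k => \sum_(0 <= nu < p - q | (nu <= k)%N)
    A (p - q - k - 1)%N *m S *m cB ^+ (k - nu) *m E *m D nu)); last first.
  move=> k /andP[_ kn].
  rewrite subn1/= (big_nat_widen _ _ (p - q)) ?(leq_trans kn) ?leq_subr//.
  apply: eq_big => [nu|nu nuk]; first by rewrite ltnS.
  rewrite !mulmxA; congr (_ *m _ *m _ *m _ *m _).
    congr A; lia.
  congr (_ ^+ _); lia.
rewrite (exchange_big_dep_nat xpredT)//=; apply: eq_big_nat => nu _.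
by rewrite [RHS](big_nat_widenl nu 0%N).
Qed.

End recursion.

Hypothesis hB0 : \rank ((B q)^T *m B 0%N) = m.

Lemma left_inv_B0_unit : Bq1 *m B 0%N \in unitmx.
Proof.
rewrite /left_inv -mulmxA unitmx_mul unitmx_inv gram_unitmx//=.
by rewrite -row_free_unit /row_free hB0.
Qed.

Lemma sum_ord_recl_pred (V : nmodType) (n : nat) (F : nat -> V) : (0 < n)%N ->
  \sum_(j < n) F j = F 0%N + \sum_(j < n.-1) F j.+1.
Proof. by case: n => // n _; rewrite big_ord_recl. Qed.

(** A right inverse is explicit: its blocks from the second on are those of the identity moved down
    by one, and its first block is solved from the last row through the invertible [Bq1 *m B 0]. *)
Lemma calB_unit : cB \in unitmx.
Proof.
pose e := block (1%:M : 'M[R]_(\sum_(i < q) m)).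
(* [w] is [v] with its first block set to zero, so that the sum defining [v 0] does not refer to
   [v]. *)
pose w j := if j is j'.+1 then e j' else 0.
pose v j := if j is j'.+1 then e j' else
  - (invmx (Bq1 *m B 0%N) *m (e q.-1 + \sum_(j < q) Bq1 *m B j *m w j)).
suff : cB *m stack q v = 1%:M by case/mulmx1_unit.
rewrite calB_stack -[RHS]stack_block; apply: eq_stack => i _.
case: eqP => [iq|//]; rewrite -/e.
rewrite (sum_ord_recl_pred (fun j => Bq1 *m B j *m v j) q0) {1}/v mulmxN.
rewrite mulKVmx ?left_inv_B0_unit//.
rewrite (sum_ord_recl_pred (fun j => Bq1 *m B j *m w j) q0) /= mulmx0 add0r.
rewrite opprD opprK addrK; congr e.
by move/(congr1 predn): iq.
Qed.

(* [calB v = E_q] is solved by the [v] whose only nonzero block is the first. *)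
Lemma invmx_calB_calE : underA p q A *m invmx cB *m E =
  - (A p *m invmx (Bq1 *m B 0%N) *m Bq1).
Proof.
pose v (j : nat) := if j is 0%N then - (invmx (Bq1 *m B 0%N) *m Bq1) else 0.
have vE : cB *m stack q v = E.
  rewrite calB_stack.
  apply: (@eq_stack q _ _ _ (fun i => if i.+1 == q then Bq1 else 0)).
  move=> i _; case: eqP => // _.
  rewrite (sum_ord_recl_pred (fun j => Bq1 *m B j *m v j) q0) /= mulmxN.
  rewrite mulKVmx ?left_inv_B0_unit//.
  by rewrite big1 ?addr0 ?opprK// => j _; rewrite mulmx0.
rewrite -mulmxA -vE mulKmx ?calB_unit// underA_stack.
rewrite (sum_ord_recl_pred (fun j => A (p - j)%N *m v j) q0) /= subn0.
rewrite big1 ?addr0; last by move=> j _; rewrite mulmx0.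
by rewrite mulmxN mulmxA.
Qed.

End coefficients.
End block_algebra.

(** * Recovering the noise *)

Section matrix_derivatives.
Variable R : realType.

Lemma mxrderiv_sum (I : finType) k l (F : I -> R -> 'M[R]_(k, l)) t
  (L : I -> 'M[R]_(k, l)) :
  (forall i, mxrderiv (F i) t (L i)) ->
  mxrderiv (fun x => \sum_i F i x) t (\sum_i L i).
Proof.
move=> dF a b; rewrite summxE.
rewrite (_ : (fun x => _) = (fun x => \sum_i F i x a b)); last first.
  by apply/funext => x; rewrite summxE.
by apply: rderiv_sum => i; exact: dF.
Qed.

Lemma mxcontinuous_sum (I : finType) k l (F : I -> R -> 'M[R]_(k, l)) :
  (forall i, mxcontinuous (F i)) -> mxcontinuous (fun x => \sum_i F i x).
Proof.
move=> cF a b; rewrite (_ : (fun x => _) = (fun x => \sum_i F i x a b)).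
  by move=> t; apply: cvg_sum => i; exact: cF.
by apply/funext => x; rewrite summxE.
Qed.

Lemma mxrderiv_stack p m r (F : R -> nat -> 'M[R]_(m, r)) t
  (L : nat -> 'M[R]_(m, r)) :
  (forall i, (i < p)%N -> mxrderiv (F ^~ i) t (L i)) ->
  mxrderiv (fun x => stack p (F x)) t (stack p L).
Proof.
move=> dF a b; rewrite mxE.
rewrite (_ : (fun x => _) = (fun x => F x (tagnat.sig1 a) (tagnat.sig2 a) b));
  last first.
  by apply/funext => x; rewrite mxE.
exact: dF.
Qed.

Lemma mxcontinuous_stack p m r (F : R -> nat -> 'M[R]_(m, r)) :
  (forall i, (i < p)%N -> mxcontinuous (F ^~ i)) ->
  mxcontinuous (fun x => stack p (F x)).
Proof.
move=> cF a b.
rewrite (_ : (fun x => _) = (fun x => F x (tagnat.sig1 a) (tagnat.sig2 a) b)).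
  exact: cF.
by apply/funext => x; rewrite mxE.
Qed.

Lemma mxrderiv_derive1 k l (F G : R -> 'M[R]_(k, l)) : mxcontinuous F ->
  mxcontinuous G -> (forall t, mxrderiv F t (G t)) -> derive1 F = G.
Proof.
move=> cF cG dF; apply/funext => t; apply: cvg_lim => //; apply: cvg_mx => i j.
rewrite (_ : (fun h => _) = (fun h => h^-1 * (F (h + t) i j - F t i j))).
  exact: (@rderiv_is_derive _ _ (fun x => G x i j) t 1 ltr01 (cF i j)
    (fun x _ => dF x i j) (cG i j t)).
by apply/funext => h; rewrite !mxE.
Qed.

Lemma mxrderiv_right_derive1 k (F : R -> 'cV[R]_k) t L :
  mxrderiv F t L -> right_derive1 F t = L.
Proof.
move=> dF; apply: cvg_lim => //; apply: cvg_mx => i j.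
rewrite (_ : (fun h => _) = (fun h => h^-1 * (F (h + t) i j - F t i j))).
  exact: dF.
by apply/funext => h; rewrite !mxE.
Qed.

End matrix_derivatives.

Section integral_col.
Variables (R : realType) (k : nat) (y : R -> 'cV[R]_k).
Hypothesis ry : forall a, rcont_locbounded (fun u => y u a ord0).

Lemma integral_col_continuous s : mxcontinuous (integral_col s ^~ y).
Proof.
move=> a j; rewrite (_ : (fun x => _) =
  (fun t => \int[lebesgue_measure]_(u in `[s, t]) y u a ord0)); last first.
  by apply/funext => t; rewrite mxE.
exact: Rintegral_primitive_continuous.
Qed.

Lemma integral_col_rderiv s t : s <= t ->
  mxrderiv (integral_col s ^~ y) t (y t).
Proof.
move=> st a j; rewrite (_ : (fun x => _) =
  (fun t => \int[lebesgue_measure]_(u in `[s, t]) y u a ord0)); last first.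
  by apply/funext => x; rewrite mxE.
by rewrite (ord1 j); apply:
  (@Rintegral_primitive_rderiv _ (fun u => y u a ord0)).
Qed.

Lemma integral_col0 s : integral_col s s y = 0.
Proof. by apply/colP => a; rewrite !mxE set_itv1 Rintegral_set1. Qed.

Lemma integral_col_FTC (F : R -> 'cV[R]_k) s t : s <= t -> mxcontinuous F ->
  (forall x, s <= x < t -> mxrderiv F x (y x)) ->
  F t - F s = integral_col s t y.
Proof.
move=> st cF dF; apply/colP => a; rewrite !mxE.
by apply: (@rderiv_FTC _ (fun x => F x a ord0)) => // x /dF; exact.
Qed.

End integral_col.

Lemma balance_increment (V : zmodType) (a0 a1 l0 l1 s0 s1 : V) :
  (a1 - l1) + s1 = (a0 - l0) + s0 -> l1 - l0 = (a1 - a0) + (s1 - s0).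
Proof.
move=> h; have {h} : a1 + s1 - l1 = a0 + s0 - l0 by rewrite addrAC h addrAC.
rewrite addrACA -opprD; move: (a1 + s1) (a0 + s0) => u v h.
have -> : u = v - l0 + l1 by rewrite -h subrK.
by rewrite -(addrA v) addrC addKr addrC.
Qed.

(** * One path of the state process: derivatives of the output and increments of the noise *)

Section carma_path.
Variables (R : realType) (m d p q : nat) (A : nat -> 'M[R]_m)
  (B : nat -> 'M[R]_(d, m)).
Hypothesis qp : (q < p)%N.
Variables (x : R -> 'cV[R]_(\sum_(i < p) m)) (l : R -> 'cV[R]_m).
Hypothesis rx : forall a, rcont_locbounded (fun t => x t a ord0).
Hypothesis cx : mxcontinuous (fun t => x t - boldE R m p *m l t).
Hypothesis dx : forall t,
  mxrderiv (fun t => x t - boldE R m p *m l t) t (boldA p A *m x t).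

Local Notation Bq1 := (left_inv (B q)).
Local Notation cB := (calB q B).
Local Notation E := (calE q B).
Local Notation S := (last_block_row R q m).

Let c j t := block (x t) j.
Let y t := underB p q B *m x t.
Let xi t := stack q (block (x t)).
(** The closed form of [D^nu Y] for [nu < p - q], as [path_derive_output] shows. *)
Let D nu t := \sum_(j < q.+1) B j *m c (nu + j) t.

Lemma block_noise j t : (j < p)%N ->
  block (boldE R m p *m l t) j = if j.+1 == p then l t else 0.
Proof.
by move=> jp; rewrite /boldE last_block_colM block_stack// mul1mx.
Qed.

Lemma block_drift j t : (j < p)%N -> block (boldA p A *m x t) j =
  if j.+1 == p then - \sum_(i < p) A (p - i)%N *m c i t else c j.+1 t.
Proof.
by move=> jp; rewrite -{1}(stack_block (x t)) boldA_stack block_stack.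
Qed.

(** The noise enters the last block only, so the other blocks of [x] coincide with those of the
    continuous [x - E_p l]. *)
Lemma block_path j : (j.+1 < p)%N ->
  mxcontinuous (c j) /\ forall t, mxrderiv (c j) t (c j.+1 t).
Proof.
move=> jp; have jp' := ltnW jp.
have cE : c j = (fun t => block_proj R p m j *m (x t - boldE R m p *m l t)).
  apply/funext => t; rewrite mulmxBr -[X in _ = _ - X]/(block _ j).
  rewrite block_noise//.
  by rewrite (ltn_eqF jp) subr0.
split; first by rewrite cE; exact: mxcontinuousMl.
move=> t; have := mxrderivMl (M := block_proj R p m j) (@dx t).
by rewrite -cE -[X in mxrderiv _ _ X]/(block _ j) block_drift// (ltn_eqF jp).
Qed.

Lemma top_block_path :
  mxcontinuous (fun t => c p.-1 t - l t) /\
  forall t, mxrderiv (fun t => c p.-1 t - l t) t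
    (- \sum_(i < p) A (p - i)%N *m c i t).
Proof.
have p0 : (0 < p)%N by exact: leq_ltn_trans qp.
have jp : (p.-1 < p)%N by rewrite prednK.
have cE : (fun t => c p.-1 t - l t) =
    (fun t => block_proj R p m p.-1 *m (x t - boldE R m p *m l t)).
  apply/funext => t; rewrite mulmxBr -[X in _ = _ - X]/(block _ p.-1).
  rewrite block_noise//.
  by rewrite prednK// eqxx.
split; first by rewrite cE; exact: mxcontinuousMl.
move=> t; have := mxrderivMl (M := block_proj R p m p.-1) (@dx t).
by rewrite -cE -[X in mxrderiv _ _ X]/(block _ p.-1) block_drift// prednK//
  eqxx.
Qed.

Lemma output_blocks t : y t = D 0%N t.
Proof. by rewrite /y -{1}(stack_block (x t)) underB_stack. Qed.

Lemma rclb_output a : rcont_locbounded (fun t => y t a ord0).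
Proof.
rewrite (_ : (fun t => _) = (fun t => \sum_b underB p q B a b * x t b ord0)).
  by apply: rclb_sum => b; apply: rclbM => //; exact: rclb_cst.
by apply/funext => t; rewrite mxE.
Qed.

Lemma output_derivative_path nu : (nu + q.+1 < p)%N ->
  mxcontinuous (D nu) /\ forall t, mxrderiv (D nu) t (D nu.+1 t).
Proof.
move=> nup; have H (j : 'I_q.+1) : ((nu + j).+1 < p)%N.
  by apply: leq_ltn_trans nup; rewrite ltn_add2l.
split.
  by apply: mxcontinuous_sum => j; apply: mxcontinuousMl;
    case: (block_path (H j)).
move=> t; apply: mxrderiv_sum => j; rewrite addSn.
by apply: mxrderivMl; case: (block_path (H j)).
Qed.

(** In this range [D nu] involves blocks below the last one only and is continuous, so its
    right-derivative relation upgrades to a two-sided one. *)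
Lemma derive1n_output nu : (nu < p - q - 1)%N -> derive1n nu y = D nu.
Proof.
elim: nu => [|nu IH] hnu; first by apply/funext => t; exact: output_blocks.
rewrite /derive1n iterS -/(derive1n nu y) IH; last exact: ltnW.
have [h1 h2] : (nu + q.+1 < p)%N /\ (nu.+1 + q.+1 < p)%N by lia.
have [cD dD] := output_derivative_path h1.
by apply: mxrderiv_derive1 => //; case: (output_derivative_path h2).
Qed.

Lemma path_derive_output nu : (nu < p - q)%N ->
  path_derive (p - q - 1) nu y = D nu.
Proof.
move=> hnu; rewrite /path_derive; case: ltnP => [|le_nu];
  first exact: derive1n_output.
have nuE : (nu = p - q - 1)%N by lia.
(* At the top order the last block appears and only a right derivative is available; when
   [p - q = 1] the top order is zero and [path_derive] is the output itself. *)
have := derive1n_output; rewrite nuE; case NE: (p - q - 1)%N => [|N] hD.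
  by apply/funext => t; exact: output_blocks.
apply/funext => t; apply: mxrderiv_right_derive1; rewrite hD//.
have h : (N + q.+1 < p)%N by lia.
by case: (output_derivative_path h).
Qed.

Hypothesis hBq : \rank (B q) = m.

Lemma low_blocks_path :
  mxcontinuous xi /\ forall t, mxrderiv xi t (cB *m xi t + E *m y t).
Proof.
have H i : (i < q)%N -> (i.+1 < p)%N by move=> iq; exact: leq_ltn_trans qp.
split.
  by apply: (@mxcontinuous_stack _ _ _ _ (fun t => block (x t))) =>
    i /H /block_path[].
move=> t; have -> : cB *m xi t + E *m y t = stack q (fun i => c i.+1 t).
  by rewrite output_blocks; exact/esym/(stack_shift hBq (fun j => c j t) 0).
apply: (@mxrderiv_stack _ _ _ _ (fun t => block (x t))) => i /H /block_path[_].
exact.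
Qed.

(** The function [expmx ((t1 - u) *: cB) *m xi u] has right derivative
    [expmx ((t1 - u) *: cB) *m E *m y u], since the [cB] terms cancel; integrate over [[t0, t1]]. *)
Lemma low_blocks_variation t0 t1 : t0 <= t1 ->
  xi t1 = expmx ((t1 - t0) *: cB) *m xi t0
    + integral_col t0 t1 (fun u => expmx ((t1 - u) *: cB) *m E *m y u).
Proof.
move=> t01; have [cxi dxi] := low_blocks_path.
pose G u := expmx ((t1 - u) *: cB) *m xi u.
have cexp := @mxcontinuous_expmx_bwd _ _ cB t1.
rewrite -(@integral_col_FTC _ _ _ _ G)//.
- by rewrite /G subrr expmx_scale0 mul1mx addrC subrK.
- move=> a; rewrite (_ : (fun t => _) =
    (fun u => \sum_b (expmx ((t1 - u) *: cB) *m E) a b * y u b ord0)).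
    apply: rclb_sum => b; apply: rclbM; last exact: rclb_output.
    by apply: rclb_mx_continuous; exact: expmx_bwd_mul_continuous.
  by apply/funext => u; rewrite mxE.
- exact: mxcontinuousM.
move=> u _; have := mxrderivM (@mxrderiv_expmx_bwd _ _ cB t1 u) (dxi u).
by rewrite mulNmx expmx_comm mulmxDr !mulmxA addKr.
Qed.

Hypotheses (q0 : (0 < q)%N) (hB0 : \rank ((B q)^T *m B 0%N) = m).

(** In the last row, [A (p - i) *m c i] integrates to the preceding block when [i >= q], giving [W],
    and through [invmx cB] when [i < q], giving [U]. Adding both to [c p.-1 - l] yields a constant,
    whose increment is rewritten by [increment_identity]. *)
Lemma noise_increment t0 t1 : t0 <= t1 ->
  l t1 - l t0 =
      \sum_(0 <= nu < p - q)
        (S *m cB ^+ (p - q - 1 - nu) *m E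
         + \sum_(nu <= k < p - q - 1)
             A (p - q - k - 1)%N *m S *m cB ^+ (k - nu) *m E)
        *m (D nu t1 - D nu t0)
      + (underA p q A *m invmx cB
         + \sum_(1 <= k < (p - q).+1)
             A (p - q - k + 1)%N *m S *m cB ^+ (k - 1)
         + S *m cB ^+ (p - q))
        *m (xi t1 - xi t0)
      + A p *m invmx (Bq1 *m B 0%N) *m Bq1 *m integral_col t0 t1 y.
Proof.
move=> t01.
have pq0 : (0 < p - q)%N by rewrite subn_gt0.
pose V := integral_col t0 ^~ y.
(* Index [k] accounts for the row entry [q + k]: the coefficient is [A (p - (q + k))], and
   [c (k + q.-1)] is a primitive of [c (q + k)]. *)
pose W t := \sum_(k < p - q) A (p - q - k.+1 + 1)%N *m c (k + q.-1) t.
(* [invmx cB *m (xi t - E *m V t)] is a primitive of [xi]. *)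
pose U t := underA p q A *m invmx cB *m (xi t - E *m V t).
pose F t := (c p.-1 t - l t) + (W t + U t).
have [ctop dtop] := top_block_path.
have [cxi dxi] := low_blocks_path.
have Hk (k : 'I_(p - q)) : ((k + q.-1).+1 < p)%N by have := ltn_ord k; lia.
have cV : mxcontinuous V by apply: integral_col_continuous; exact: rclb_output.
have FE : F t1 = F t0.
  apply: mxrderiv_eq => //.
    apply: mxcontinuousD => //; apply: mxcontinuousD.
      by apply: mxcontinuous_sum => k; apply: mxcontinuousMl;
        case: (block_path (Hk k)).
    apply: mxcontinuousMl; apply: mxcontinuousD => //.
    by apply: mxcontinuousN; exact: mxcontinuousMl.
  move=> t /andP[t0t _].
  have dW : mxrderiv W t (\sum_(k < p - q) A (p - (q + k))%N *m c (q + k) t).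
    apply: mxrderiv_sum => k; have -> : (p - (q + k) = p - q - k.+1 + 1)%N.
      by have := ltn_ord k; lia.
    apply: mxrderivMl; have -> : (q + k = (k + q.-1).+1)%N by lia.
    by case: (block_path (Hk k)).
  have dU : mxrderiv U t (\sum_(j < q) A (p - j)%N *m c j t).
    have dV := integral_col_rderiv rclb_output t0t.
    have := mxrderivMl (M := underA p q A *m invmx cB)
      (mxrderivD (dxi t) (mxrderivN (mxrderivMl (M := E) dV))).
    by rewrite addrK -mulmxA mulKmx ?calB_unit// underA_stack.
  have := mxrderivD (dtop t) (mxrderivD dW dU).
  rewrite (_ : \sum_(i < p) _ =
    \sum_(k < p - q) A (p - (q + k))%N *m c (q + k) t
    + \sum_(j < q) A (p - j)%N *m c j t) ?addNr//.
  rewrite -(big_mkord xpredT (fun i => A (p - i)%N *m c i t)).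
  rewrite (big_cat_nat (n := q)) ?(ltnW qp)//= addrC big_mkord; congr (_ + _).
  rewrite -{1}(add0n q) big_addn big_mkord.
  by apply: eq_bigr => k _; rewrite addnC.
(* The recursion is linear, so it applies directly to the increments of the blocks. *)
pose c' j := block (x t1 - x t0) j.
have cE j : c j t1 - c j t0 = c' j by rewrite /c' /block mulmxBr.
have DE nu : D nu t1 - D nu t0 = \sum_(j < q.+1) B j *m c' (nu + j)%N.
  by rewrite /D -sumrB; apply: eq_bigr => j _; rewrite -mulmxBr cE.
have xiE : xi t1 - xi t0 = stack q (fun i => c' (0 + i)%N).
  by rewrite /xi /stack -mxcolB; apply/eq_mxcolP => i; exact: cE.
have := increment_identity A qp q0 hBq c' pq0.
rewrite -xiE big_add1/= big_mkord => II.
have lE : l t1 - l t0 = (c p.-1 t1 - c p.-1 t0) + (W t1 + U t1 - (W t0 + U t0)).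
  exact: balance_increment FE.
have UE : U t1 - U t0 = underA p q A *m invmx cB *m (xi t1 - xi t0) +
    A p *m invmx (Bq1 *m B 0%N) *m Bq1 *m integral_col t0 t1 y.
  rewrite /U -mulmxBr /V integral_col0 mulmx0 subr0 addrAC mulmxBr mulmxA.
  by rewrite (invmx_calB_calE p A q0 hBq hB0) mulNmx opprK.
have WE : W t1 - W t0 =
    \sum_(k < p - q) A (p - q - k.+1 + 1)%N *m c' (k.+1 - 1 + q.-1)%N.
  by rewrite /W -sumrB; apply: eq_bigr => k _; rewrite -mulmxBr cE subn1.
clear FE F; clearbody U W.
rewrite lE opprD (addrACA (W t1)) UE WE cE addrA II.
under [in RHS]eq_bigr do rewrite DE.
rewrite -[underA _ _ _ *m _ + _ + _]addrA (mulmxDl (underA _ _ _ *m _)).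
by rewrite -!addrA; congr (_ + _); rewrite addrCA.
Qed.

End carma_path.

Theorem theorem4p3
  (R : realType) (dsp : measure_display) (Omega : measurableType dsp)
  (P : probability Omega R)
  (m d p q : nat) (hqp : (q < p)%N) (hq : (0 < q)%N) (hmd : (m <= d)%N)
  (A : nat -> 'M[R]_m) (B : nat -> 'M[R]_(d, m))
  (hBq : \rank (B q) = m)
  (hB0 : \rank ((B q)^T *m B 0%N) = m)
  (hzeros : forall z : R[i],
     \det (toC (left_inv (B q)) *m Qpoly q B z) = 0 -> complex.Re z < 0)
  (L : R -> Omega -> 'cV[R]_m) (hL : levy_process P L)
  (X : R -> Omega -> 'cV[R]_(\sum_(i < p) m))
  (hX : state_process P (boldA p A) (boldE R m p) L X)
  (Y : R -> Omega -> 'cV[R]_d)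
  (hY : forall t w, Y t w = underB p q B *m X t w)
  (n : nat) (hn : (1 <= n)%N) :
  let Bq1 := left_inv (B q) in
  let cB := calB q B in
  let E := calE q B in
  let S := last_block_row R q m in
  let Xq := fun t w => first_blocks (ltnW hqp) (X t w) in
  let D := fun nu w => path_derive (p - q - 1) nu (Y ^~ w) in
  let t1 : R := n%:R in
  let t0 : R := n%:R - 1 in
  {ae P, forall w,
    L t1 w - L t0 w =
      \sum_(0 <= nu < p - q)
        (S *m cB ^+ (p - q - 1 - nu) *m E
         + \sum_(nu <= k < p - q - 1)
             A (p - q - k - 1)%N *m S *m cB ^+ (k - nu) *m E)
        *m (D nu w t1 - D nu w t0)
      + (underA p q A *m invmx cB
         + \sum_(1 <= k < (p - q).+1)
             A (p - q - k + 1)%N *m S *m cB ^+ (k - 1)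
         + S *m cB ^+ (p - q))
        *m (Xq t1 w - Xq t0 w)
      + A p *m invmx (Bq1 *m B 0%N) *m Bq1
        *m integral_col t0 t1 (fun s => Y s w)
    /\
    Xq t1 w =
      expmx cB *m Xq t0 w
      + integral_col t0 t1 (fun u => expmx ((t1 - u) *: cB) *m E *m Y u w)}.
Proof.
move=> Bq1 cB E S Xq D t1 t0.
have t01 : t0 <= t1 by rewrite /t0 gerBl.
apply: filterS (state_process_paths hL hX) => w [rX cZ dZ].
have YE : Y ^~ w = (fun t => underB p q B *m X t w) by apply/funext => t.
rewrite /D /Xq !first_blocksE YE; split.
  rewrite (noise_increment hqp rX cZ dZ hBq hq hB0 t01); congr (_ + _ + _).
  apply: eq_big_nat => nu /andP[_ nup]; congr (_ *m _).
  by rewrite !(path_derive_output B hqp cZ dZ nup).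
have t10 : t1 - t0 = 1 by rewrite /t0 subKr.
rewrite (low_blocks_variation hqp rX cZ dZ hBq t01) t10 scale1r.
suff -> : (fun u => expmx ((t1 - u) *: cB) *m E *m Y u w) =
  (fun u => expmx ((t1 - u) *: cB) *m E *m (underB p q B *m X u w)) by [].
by apply/funext => u; rewrite hY.
Qed.
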